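(* Let $T$ be a generalized probabilistic theory, let $G$ be a finite group acting on $T$ by symmetries $\alpha_g$, and let $sT$ be the $G$-invariant subtheory. Suppose: (H1) $T$ contains a system $R$ with states $\{\varphi_g\}_{g\in G}$ and a measurement $\{Q_g\}_{g\in G}$ of $T$ such that $\alpha_h\varphi_g=\varphi_{hg}$, $\alpha_hQ_g=Q_{hg}$ and $\langle Q_g,\varphi_{g'}\rangle=\delta_{gg'}$ for all $g,g',h\in G$; (H2) for every $k\ge1$ the perfectly correlated frame state $|G|^{-1}\sum_{g\in G}\varphi_g^{\otimes k}$ on $k$ copies of $R$ is a state of $sT$; (H3) the effect set $\mathcal E(T)$ and the operation set $\mathcal O(T)$ are sectorially closed, i.e. invariant under $\alpha_{\vec g}$ for every tuple $\vec g$ of elements of $G$ indexed by wires and every number of wires (effects under $E\mapsto\alpha_{\vec g}(E)$, operations under $\Lambda\mapsto\alpha_{\vec g}\circ\Lambda\circ\alpha_{\vec g}^{-1}$); (H4) the encoded effects $\xi(E)$, $E\in\mathcal E(T)$, and the encoded operations $\tilde\Lambda$, $\Lambda\in\mathcal O(T)$, defined in the context, satisfy the restrictions of $T$ on the enlarged systems (wires and registers together), i.e. belong to $\mathcal E(T)$ and $\mathcal O(T)$ respectively. Then $\mathrm{corr}_T=\mathrm{corr}_{sT}$ in every causal structure, where each wire is permitted to carry a register $R$ emitted by the source of that wire and held by whichever party holds it.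
   Context: **Theories.** A generalized probabilistic theory $T$ here is tomographically local: each wire $w$ has a finite-dimensional real vector space, a system is a finite list of wires with the tensor product space, and each system has a convex set of normalised states, a convex set $\mathcal E(T)$ of effects (linear functionals, paired with states by $\langle\cdot,\cdot\rangle$ with values in $[0,1]$, containing $0$ and the unit effect and closed under $E\mapsto \text{unit}-E$), states and effects being tomographic for one another; $\mathcal O(T)$ is a set of normalisation-preserving linear maps between systems (with instruments, i.e. finite families of admissible maps summing to an operation, included), containing identities and closed under sequential and parallel composition, mapping states to states and, by adjoint, effects to effects. States and effects are closed under tensor products. A measurement is a finite family of effects summing to the unit. Input and output wires of an operation are labelled by a common index set (each label on at most one input and at most one output wire). **Symmetries.** $G$ acts on each wire $w$ by reversible linear maps $\alpha_g^w$; on a $k$-wire system $g$ acts collectively by $\alpha_g^{\otimes k}$, and this preserves states, effects (acting so that $\langle\alpha_g(E),\alpha_g(\rho)\rangle=\langle E,\rho\rangle$), and $\mathcal O(T)$ under conjugation. For a tuple $\vec g$ indexed by wires, $\alpha_{\vec g}=\bigotimes_w\alpha^w_{g_w}$. In $\alpha_{\vec g}\circ\Lambda\circ\alpha_{\vec g}^{-1}$, the tuple is indexed by labels, so that an input and an output wire with the same label get the same group element. $sT$ is the subtheory whose states, effects and operations are those of $T$ invariant under the collective action of $G$. **Encoding.** Adjoin to each wire $w$ a copy $R_w$ of $R$. A party holding $n$ wires and measuring $E$ gets the encoded effect $$\xi(E)=\sum_{\vec g\in G^n}\alpha_{\vec g}(E)\otimes\bigotimes_wQ_{g_w}.$$ An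 operation $\Lambda$ (or element of an instrument) is encoded as the map $\tilde\Lambda$ that acts on the sector $\vec g$ of the registers of its input wires (reading the registers with $\{Q_g\}$ and repreparing $\varphi_g$) as $\alpha_{\vec g}\circ\Lambda\circ\alpha_{\vec g}^{-1}$: $$\tilde\Lambda(X)=\sum_{\vec g}\bigl(\alpha_{\vec g}\circ\Lambda\circ\alpha_{\vec g}^{-1}\bigr)\Bigl(\bigl\langle\textstyle\bigotimes_wQ_{g_w},X\bigr\rangle_R\Bigr)\otimes\bigotimes_{w\in\text{outputs}}\varphi_{g_w},$$ where $\langle\cdot,X\rangle_R$ is the partial pairing on the registers, and an output wire whose label is not an input label inherits a copy of the group element of a chosen input wire. A discarded wire's register is discarded with it. **Causal structures and correlations.** A causal structure is a finite directed acyclic graph whose nodes are sources (no incoming edges), intermediate boxes (at least one incoming edge) and parties (no outgoing edges), together with finite sets of setting values and outcome values (possibly trivial) for each box and party and a specification of which settings and which earlier outcomes each may depend on. A realisation in a theory $X$ assigns to each edge a finite list of wires (so an edge may carry registers alongside a system), to each source a state of $X$ on its outgoing wires, to each box, for each value of the classical data it sees, an instrument of $X$ from its incoming wires (at least one) to its outgoing wires, and to each party, for each value of the classical data it sees, a measurement of $X$. Labels are consistent along edges. $\mathrm{corr}_X$ is the set of conditional distributions $P(\text{outcomes}\mid\text{settings})$ obtained from realisations in $X$. *)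

(* Defs.v *)
From mathcomp Require Import all_boot all_order all_algebra all_fingroup.
From mathcomp Require Import reals.

Set Implicit Arguments.
Unset Strict Implicit.
Unset Printing Implicit Defensive.

Import Order.TTheory GRing.Theory Num.Theory.
Local Open Scope ring_scope.

(* The space of a wire w is R^(dim w), a basis being fixed once and for all.  A
   system is a finite family of wires; the indices only serve to name the factors
   of the tensor product, in place of the positions of a list, and theories are
   required below to be insensitive to the choice of names (in particular, to the
   order of the factors). *)

Record wire_kind := WireKind { wire :> Type; dim : wire -> nat }.

Record system (W : wire_kind) := Sys { idx :> finType; wire_at : idx -> W }.
Arguments wire_at {W} s _.

(* product basis of the tensor product of the spaces of the wires of S *)
Definition bas (W : wire_kind) (S : system W) : finType :=
  {dffun forall i : idx S, 'I_(dim (wire_at S i))}.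

(* coordinates of a vector of the tensor product space, or of a functional on it
   in the dual basis *)
Definition vec (R : realType) (W : wire_kind) (S : system W) : zmodType :=
  {ffun bas S -> R}.

(* matrix of a linear map from the space of S to the space of S', the output
   index first *)
Definition hom (R : realType) (W : wire_kind) (S S' : system W) : zmodType :=
  {ffun bas S' * bas S -> R}.

Definition pairing (R : realType) (W : wire_kind) (S : system W)
  (E rho : vec R S) : R := \sum_b E b * rho b.

Definition app (R : realType) (W : wire_kind) (S S' : system W)
  (F : hom R S S') (rho : vec R S) : vec R S' :=
  [ffun b => \sum_a F (b, a) * rho a].

Definition adjoint (R : realType) (W : wire_kind) (S S' : system W)
  (F : hom R S S') (E : vec R S') : vec R S :=
  [ffun a => \sum_b E b * F (b, a)].

Definition hom_id (R : realType) (W : wire_kind) (S : system W) : hom R S S :=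
  [ffun p => (p.1 == p.2)%:R].

Definition hom_comp (R : realType) (W : wire_kind) (S S' S'' : system W)
  (F' : hom R S' S'') (F : hom R S S') : hom R S S'' :=
  [ffun p => \sum_c F' (p.1, c) * F (c, p.2)].

Definition sum_case (A B C : Type) (f : A -> C) (g : B -> C) (x : A + B) : C :=
  match x with inl a => f a | inr b => g b end.

Definition tens (W : wire_kind) (S S' : system W) : system W :=
  @Sys W (idx S + idx S')%type (sum_case (wire_at S) (wire_at S')).

Definition bas_l (W : wire_kind) (S S' : system W) (b : bas (tens S S')) :
  bas S := [ffun i : S => (b (inl i) : 'I_(dim (wire_at S i)))].

Definition bas_r (W : wire_kind) (S S' : system W) (b : bas (tens S S')) :
  bas S' := [ffun i : S' => (b (inr i) : 'I_(dim (wire_at S' i)))].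

Definition vec_tens (R : realType) (W : wire_kind) (S S' : system W)
  (x : vec R S) (y : vec R S') : vec R (tens S S') :=
  [ffun b => x (bas_l b) * y (bas_r b)].

Definition hom_tens (R : realType) (W : wire_kind) (S1 S1' S2 S2' : system W)
  (F1 : hom R S1 S1') (F2 : hom R S2 S2') :
  hom R (tens S1 S2) (tens S1' S2') :=
  [ffun p => F1 (bas_l p.1, bas_l p.2) * F2 (bas_r p.1, bas_r p.2)].

(* the system S with its wires renamed along f *)
Definition reindex (W : wire_kind) (S : system W) (I : finType) (f : I -> S) :
  system W := @Sys W I (fun i => wire_at S (f i)).

Definition bas_reindex (W : wire_kind) (S : system W) (I : finType)
  (f : I -> S) (b : bas S) : bas (reindex f) :=
  [ffun i : I => (b (f i) : 'I_(dim (wire_at S (f i))))].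

Definition vec_reindex (R : realType) (W : wire_kind) (S : system W)
  (I : finType) (f : I -> S) (x : vec R (reindex f)) : vec R S :=
  [ffun b => x (bas_reindex f b)].

Definition hom_reindex (R : realType) (W : wire_kind) (S S' : system W)
  (I I' : finType) (f : I -> S) (f' : I' -> S')
  (F : hom R (reindex f) (reindex f')) : hom R S S' :=
  [ffun p => F (bas_reindex f' p.1, bas_reindex f p.2)].

(* A class of linear maps whose input and output wires carry labels: lin and
   lout give the labels of the input and of the output wires. *)
Definition map_class (R : realType) (W : wire_kind) : Type :=
  forall (L : finType) (S S' : system W) (lin : S -> L) (lout : S' -> L),
    hom R S S' -> Prop.

(* The normalisation functional of a system is the tensor product of those of
   its wires.  Operations preserve normalisation; an admissible map is one that may
   occur as an element of an instrument. *)
Record theory (R : realType) (W : wire_kind) := Theory {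
  unit_wire : forall w : W, 'rV[R]_(dim w);
  state : forall S : system W, vec R S -> Prop;
  effect : forall S : system W, vec R S -> Prop;
  operation : map_class R W;
  admissible : map_class R W }.

Definition unit_effect (R : realType) (W : wire_kind) (T : theory R W)
  (S : system W) : vec R S :=
  [ffun b : bas S => \prod_i unit_wire T (wire_at S i) 0 (b i)].

Definition measurement (R : realType) (W : wire_kind) (T : theory R W)
  (S : system W) (K : finType) (E : K -> vec R S) : Prop :=
  (forall k, effect T (E k)) /\ \sum_k E k = unit_effect T S.

Definition instrument (R : realType) (W : wire_kind) (T : theory R W)
  (L : finType) (S S' : system W) (lin : S -> L) (lout : S' -> L)
  (K : finType) (F : K -> hom R S S') : Prop :=
  (forall k, admissible T lin lout (F k)) /\
  operation T lin lout (\sum_k F k).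

Definition convex (R : realType) (W : wire_kind) (S : system W)
  (A : vec R S -> Prop) : Prop :=
  forall (t : R) (x y : vec R S), 0 <= t -> t <= 1 -> A x -> A y ->
    A [ffun b => t * x b + (1 - t) * y b].

Record closed_map_class (R : realType) (W : wire_kind) (T : theory R W)
    (M : map_class R W) : Prop := {
  mc_labels : forall (L : finType) (S S' : system W) (lin : S -> L) (lout : S' -> L) F,
    M L S S' lin lout F -> injective lin /\ injective lout;
  mc_comp : forall (L : finType) (S S' S'' : system W) (l : S -> L) (l' : S' -> L) (l'' : S'' -> L) F F',
    M L S S' l l' F -> M L S' S'' l' l'' F' -> M L S S'' l l'' (hom_comp F' F);
  mc_tens : forall (L : finType) (S1 S1' S2 S2' : system W) (l1 : S1 -> L) (l1' : S1' -> L)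
      (l2 : S2 -> L) (l2' : S2' -> L) F1 F2,
    M L S1 S1' l1 l1' F1 -> M L S2 S2' l2 l2' F2 ->
    injective (sum_case l1 l2) -> injective (sum_case l1' l2') ->
    M L (tens S1 S2) (tens S1' S2') (sum_case l1 l2) (sum_case l1' l2')
      (hom_tens F1 F2);
  mc_effect : forall (L : finType) (S S' : system W) (lin : S -> L) (lout : S' -> L) F E,
    M L S S' lin lout F -> effect T E -> effect T (adjoint F E);
  mc_reindex : forall (L : finType) (S S' : system W) (lin : S -> L) (lout : S' -> L)
      (I I' : finType) (f : I -> S) (f' : I' -> S')
      (F : hom R (reindex f) (reindex f')),
    bijective f -> bijective f' ->
    (M L (reindex f) (reindex f') (fun i => lin (f i)) (fun i => lout (f' i)) F
     <-> M L S S' lin lout (hom_reindex F));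
  mc_relabel : forall (L L' : finType) (S S' : system W) (lin : S -> L) (lout : S' -> L)
      (h : L -> L') F,
    injective h ->
    (M L S S' lin lout F
     <-> M L' S S' (fun i => h (lin i)) (fun i => h (lout i)) F) }.

Record is_gpt (R : realType) (W : wire_kind) (T : theory R W) : Prop := {
  gpt_state_norm : forall (S : system W) (rho : vec R S),
    state T rho -> pairing (unit_effect T S) rho = 1;
  gpt_state_convex : forall S, convex (@state R W T S);
  gpt_state_tens : forall (S S' : system W) (rho : vec R S) (rho' : vec R S'),
    state T rho -> state T rho' -> state T (vec_tens rho rho');
  gpt_state_reindex : forall (S : system W) (I : finType) (f : I -> S)
      (rho : vec R (reindex f)),
    bijective f -> (state T rho <-> state T (vec_reindex rho));
  gpt_effect_range : forall (S : system W) (E rho : vec R S),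
    effect T E -> state T rho -> 0 <= pairing E rho <= 1;
  gpt_effect_convex : forall S, convex (@effect R W T S);
  gpt_effect_0 : forall S : system W, effect T (0 : vec R S);
  gpt_effect_unit : forall S : system W, effect T (unit_effect T S);
  gpt_effect_compl : forall (S : system W) (E : vec R S),
    effect T E -> effect T (unit_effect T S - E);
  gpt_effect_tens : forall (S S' : system W) (E : vec R S) (E' : vec R S'),
    effect T E -> effect T E' -> effect T (vec_tens E E');
  gpt_effect_reindex : forall (S : system W) (I : finType) (f : I -> S)
      (E : vec R (reindex f)),
    bijective f -> (effect T E <-> effect T (vec_reindex E));
  gpt_state_tomo : forall (S : system W) (rho rho' : vec R S), state T rho -> state T rho' ->
    (forall E, effect T E -> pairing E rho = pairing E rho') -> rho = rho';
  gpt_effect_tomo : forall (S : system W) (E E' : vec R S), effect T E -> effect T E' ->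
    (forall rho, state T rho -> pairing E rho = pairing E' rho) -> E = E';
  gpt_operation_class : closed_map_class T (operation T);
  gpt_operation_norm : forall (L : finType) (S S' : system W) (lin : S -> L) (lout : S' -> L) F,
    operation T lin lout F -> adjoint F (unit_effect T S') = unit_effect T S;
  gpt_operation_state : forall (L : finType) (S S' : system W) (lin : S -> L) (lout : S' -> L) F rho,
    operation T lin lout F -> state T rho -> state T (app F rho);
  gpt_operation_id : forall (L : finType) (S : system W) (l : S -> L),
    injective l -> operation T l l (hom_id R S);
  gpt_admissible_class : closed_map_class T (admissible T);
  gpt_operation_admissible : forall (L : finType) (S S' : system W) (lin : S -> L) (lout : S' -> L) F,
    operation T lin lout F -> admissible T lin lout F }.

Record waction (R : realType) (W : wire_kind) (G : finGroupType) := WAction {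
  act_mx : forall w : W, G -> 'M[R]_(dim w);
  act_mx1 : forall w, act_mx w 1%g = 1%:M;
  act_mxM : forall w g h, act_mx w (g * h)%g = act_mx w g *m act_mx w h }.

(* matrix of the tensor product of the maps by which the g i act on the wires *)
Definition act_hom (R : realType) (W : wire_kind) (G : finGroupType)
  (alpha : waction R W G) (S : system W) (g : S -> G) : hom R S S :=
  [ffun p : bas S * bas S =>
     \prod_i act_mx alpha (wire_at S i) (g i) (p.1 i) (p.2 i)].

Definition act_state (R : realType) (W : wire_kind) (G : finGroupType)
  (alpha : waction R W G) (S : system W) (g : S -> G) (rho : vec R S) :
  vec R S := app (act_hom alpha g) rho.

(* the contragredient action, for which the pairing is invariant *)
Definition act_effect (R : realType) (W : wire_kind) (G : finGroupType)
  (alpha : waction R W G) (S : system W) (g : S -> G) (E : vec R S) :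
  vec R S := adjoint (act_hom alpha (fun i => (g i)^-1%g)) E.

Definition act_map (R : realType) (W : wire_kind) (G : finGroupType)
  (alpha : waction R W G) (S S' : system W) (gin : S -> G) (gout : S' -> G)
  (F : hom R S S') : hom R S S' :=
  hom_comp (act_hom alpha gout)
    (hom_comp F (act_hom alpha (fun i => (gin i)^-1%g))).

Record is_symmetry (R : realType) (W : wire_kind) (G : finGroupType)
    (alpha : waction R W G) (T : theory R W) : Prop := {
  sym_state : forall (g : G) (S : system W) (rho : vec R S),
    state T rho -> state T (act_state alpha (fun=> g) rho);
  sym_effect : forall (g : G) (S : system W) (E : vec R S),
    effect T E -> effect T (act_effect alpha (fun=> g) E);
  sym_operation : forall (g : G) (L : finType) (S S' : system W) (lin : S -> L) (lout : S' -> L) F,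
    operation T lin lout F ->
    operation T lin lout (act_map alpha (fun=> g) (fun=> g) F);
  sym_admissible : forall (g : G) (L : finType) (S S' : system W) (lin : S -> L) (lout : S' -> L) F,
    admissible T lin lout F ->
    admissible T lin lout (act_map alpha (fun=> g) (fun=> g) F) }.

Definition invariant_map (R : realType) (W : wire_kind) (G : finGroupType)
  (alpha : waction R W G) (S S' : system W) (F : hom R S S') : Prop :=
  forall g : G, act_map alpha (fun=> g) (fun=> g) F = F.

Definition subtheory (R : realType) (W : wire_kind) (G : finGroupType)
  (alpha : waction R W G) (T : theory R W) : theory R W :=
  {| unit_wire := unit_wire T;
     state := fun S rho =>
       state T rho /\ forall g : G, act_state alpha (fun=> g) rho = rho;
     effect := fun S E =>
       effect T E /\ forall g : G, act_effect alpha (fun=> g) E = E;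
     operation := fun L S S' lin lout F =>
       operation T lin lout F /\ invariant_map alpha F;
     admissible := fun L S S' lin lout F =>
       admissible T lin lout F /\ invariant_map alpha F |}.

Record reference_frame (R : realType) (W : wire_kind) (G : finGroupType)
    (alpha : waction R W G) (T : theory R W) (r : system W)
    (phi Q : G -> vec R r) : Prop := {
  frame_state : forall g, state T (phi g);
  frame_measurement : measurement T Q;
  frame_act_state : forall h g, act_state alpha (fun=> h) (phi g) = phi (h * g)%g;
  frame_act_effect : forall h g, act_effect alpha (fun=> h) (Q g) = Q (h * g)%g;
  frame_pairing : forall g g', pairing (Q g) (phi g') = (g == g')%:R }.

Definition copies (W : wire_kind) (k : nat) (r : system W) : system W :=
  @Sys W ('I_k * idx r)%type (fun x => wire_at r x.2).

Definition bas_copy (W : wire_kind) (k : nat) (r : system W)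
  (b : bas (copies k r)) (i : 'I_k) : bas r :=
  [ffun j : r => (b (i, j) : 'I_(dim (wire_at r j)))].

Definition frame_corr_state (R : realType) (W : wire_kind) (G : finGroupType)
  (r : system W) (phi : G -> vec R r) (k : nat) : vec R (copies k r) :=
  [ffun b => (#|G|%:R)^-1 * \sum_g \prod_(i < k) phi g (bas_copy b i)].

Definition frame_corr_states (R : realType) (W : wire_kind) (G : finGroupType)
  (alpha : waction R W G) (T : theory R W) (r : system W)
  (phi : G -> vec R r) : Prop :=
  forall k, (1 <= k)%N -> state (subtheory alpha T) (frame_corr_state phi k).

Record sectorially_closed (R : realType) (W : wire_kind) (G : finGroupType)
    (alpha : waction R W G) (T : theory R W) : Prop := {
  sect_effect : forall (S : system W) (E : vec R S) (g : S -> G),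
    effect T E -> effect T (act_effect alpha g E);
  sect_operation : forall (L : finType) (S S' : system W) (lin : S -> L) (lout : S' -> L) F
      (g : L -> G),
    operation T lin lout F ->
    operation T lin lout
      (act_map alpha (fun i => g (lin i)) (fun j => g (lout j)) F);
  sect_admissible : forall (L : finType) (S S' : system W) (lin : S -> L) (lout : S' -> L) F
      (g : L -> G),
    admissible T lin lout F ->
    admissible T lin lout
      (act_map alpha (fun i => g (lin i)) (fun j => g (lout j)) F) }.

(* S with a copy of the register r adjoined to each wire: inl i is the wire i,
   and inr (i, j) is the j-th wire of its register. *)
Definition enlarge (W : wire_kind) (r S : system W) : system W :=
  @Sys W (idx S + idx S * idx r)%type
    (sum_case (wire_at S) (fun x : S * r => wire_at r x.2)).

Definition bas_wires (W : wire_kind) (r S : system W)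
  (b : bas (enlarge r S)) : bas S :=
  [ffun i : S => (b (inl i) : 'I_(dim (wire_at S i)))].

Definition bas_register (W : wire_kind) (r S : system W)
  (b : bas (enlarge r S)) (i : S) : bas r :=
  [ffun j : r => (b (inr (i, j)) : 'I_(dim (wire_at r j)))].

(* the register of a wire labelled l has its wires labelled by l and by their
   position in the register *)
Definition enlarge_label (W : wire_kind) (r S : system W) (L : finType)
  (l : S -> L) (x : enlarge r S) : (L + L * idx r)%type :=
  match x with inl i => inl (l i) | inr y => inr (l y.1, y.2) end.

Definition encode_effect (R : realType) (W : wire_kind) (G : finGroupType)
  (alpha : waction R W G) (r : system W) (Q : G -> vec R r)
  (S : system W) (E : vec R S) : vec R (enlarge r S) :=
  [ffun b => \sum_(g : {ffun idx S -> G})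
     act_effect alpha g E (bas_wires b) * \prod_i Q (g i) (bas_register b i)].

(* from j is the input wire whose group element is passed to the output wire j *)
Definition encode_map (R : realType) (W : wire_kind) (G : finGroupType)
  (alpha : waction R W G) (r : system W) (phi Q : G -> vec R r)
  (S S' : system W) (from : S' -> S) (F : hom R S S') :
  hom R (enlarge r S) (enlarge r S') :=
  [ffun p => \sum_(g : {ffun idx S -> G})
     act_map alpha g (fun j => g (from j)) F (bas_wires p.1, bas_wires p.2)
     * (\prod_i Q (g i) (bas_register p.2 i))
     * \prod_j phi (g (from j)) (bas_register p.1 j)].

Definition from_labels (L A B : Type) (lin : A -> L) (lout : B -> L)
  (from : B -> A) : Prop := forall i j, lin i = lout j -> from j = i.

(* The input wire chosen for an output wire with a new label depends only
   on the labelled input and output systems, so that the encodings of the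
   elements of an instrument sum to the encoding of their sum.  It exists only
   when there is an input wire. *)
Record encodings_admitted (R : realType) (W : wire_kind) (G : finGroupType)
    (alpha : waction R W G) (T : theory R W) (r : system W)
    (phi Q : G -> vec R r) : Prop := {
  enc_effect : forall (S : system W) (E : vec R S),
    effect T E -> effect T (encode_effect alpha Q E);
  enc_map : forall (L : finType) (S S' : system W) (lin : S -> L)
      (lout : S' -> L),
    (0 < #|S|)%N -> injective lin -> injective lout ->
    exists from : S' -> S, [/\ from_labels lin lout from,
      forall F, operation T lin lout F ->
        operation T (enlarge_label (r := r) lin) (enlarge_label (r := r) lout)
          (encode_map alpha phi Q from F)
      & forall F, admissible T lin lout F ->
        admissible T (enlarge_label (r := r) lin) (enlarge_label (r := r) lout)
          (encode_map alpha phi Q from F)] }.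

Definition acyclic (V : finType) (e : rel V) : Prop :=
  forall x y, e x y -> ~~ connect e y x.

(* Sources and parties have respectively no incoming and no outgoing edge by the
   types of tail and head; parallel edges are allowed.  sees_setting v u (resp.
   sees_outcome v u) means that v may depend on the setting (resp. outcome) of u.
   Acyclicity bears on edges and outcome dependences together: this is what
   makes the outcomes seen earlier ones. *)
Record causal_structure := CausalStructure {
  source : finType;
  box : finType;
  party : finType;
  edge : finType;
  tail : edge -> (source + box)%type;
  head : edge -> (box + party)%type;
  setting : (box + party)%type -> finType;
  outcome : (box + party)%type -> finType;
  sees_setting : rel (box + party)%type;
  sees_outcome : rel (box + party)%type;
  box_incoming : forall v : box, exists e, head e = inl v;
  causal_acyclic : acyclic (fun u v : (box + party)%type =>
    [exists e, (head e == v) &&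
       (match u with inl x => tail e == inr x | inr _ => false end)]
    || sees_outcome v u) }.

Definition settings (C : causal_structure) : Type := forall u, setting (c := C) u.
Definition outcomes (C : causal_structure) : Type := forall u, outcome (c := C) u.

Definition seen (C : causal_structure) (v : (box C + party C)%type) : Type :=
  ((forall u, sees_setting v u -> setting u) *
   (forall u, sees_outcome v u -> outcome u))%type.

Definition seen_by (C : causal_structure) (x : settings C) (a : outcomes C)
  (v : (box C + party C)%type) : seen v := (fun u _ => x u, fun u _ => a u).

Definition subsystem (W : wire_kind) (S : system W) (P : pred S) : system W :=
  @Sys W {i : idx S | P i} (fun i => wire_at S (val i)).

Definition bas_sub (W : wire_kind) (S : system W) (P : pred S) (b : bas S) :
  bas (subsystem P) :=
  [ffun i : {i : S | P i} => (b (val i) : 'I_(dim (wire_at S (val i))))].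

Definition all_wires (W : wire_kind) (C : causal_structure)
  (carry : edge C -> system W) : system W :=
  @Sys W {e : edge C & idx (carry e)} (fun x => wire_at (carry (tag x)) (tagged x)).

Definition is_out (W : wire_kind) (C : causal_structure)
  (carry : edge C -> system W) (t : (source C + box C)%type) :
  pred (all_wires carry) := fun x => tail (tag x) == t.

Definition is_in (W : wire_kind) (C : causal_structure)
  (carry : edge C -> system W) (h : (box C + party C)%type) :
  pred (all_wires carry) := fun x => head (tag x) == h.

Definition out_sys (W : wire_kind) (C : causal_structure)
  (carry : edge C -> system W) (t : (source C + box C)%type) : system W :=
  subsystem (@is_out W C carry t).

Definition in_sys (W : wire_kind) (C : causal_structure)
  (carry : edge C -> system W) (h : (box C + party C)%type) : system W :=
  subsystem (@is_in W C carry h).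

(* A wire has the same label at both ends of the edge that carries it. *)
Record realisation (R : realType) (W : wire_kind) (X : theory R W)
    (C : causal_structure) := Realisation {
  carry : edge C -> system W;
  label : finType;
  label_of : all_wires carry -> label;
  prep : forall s : source C, vec R (out_sys carry (inl s));
  inst : forall v : box C, seen (C := C) (inl v) -> outcome (c := C) (inl v) ->
    hom R (in_sys carry (inl v)) (out_sys carry (inr v));
  meas : forall p : party C, seen (C := C) (inr p) -> outcome (c := C) (inr p) ->
    vec R (in_sys carry (inr p));
  prep_state : forall s, state X (prep s);
  inst_input : forall v, (0 < #|in_sys carry (inl v)|)%N;
  inst_instrument : forall v d,
    instrument X (fun i : in_sys carry (inl v) => label_of (val i))
      (fun i : out_sys carry (inr v) => label_of (val i)) (@inst v d);
  meas_measurement : forall p d, measurement X (@meas p d) }.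

(* The value of the network of states, instrument elements and effects, i.e. the
   contraction of their coordinates along all wires. *)
Definition prob (R : realType) (W : wire_kind) (X : theory R W)
  (C : causal_structure) (r : realisation X C) (a : outcomes C)
  (x : settings C) : R :=
  \sum_(b : bas (all_wires (carry r)))
    (\prod_(s : source C) prep r s (bas_sub (@is_out W C (carry r) (inl s)) b))
    * (\prod_(v : box C) inst r (seen_by x a (inl v)) (a (inl v))
         (bas_sub (@is_out W C (carry r) (inr v)) b, bas_sub (@is_in W C (carry r) (inl v)) b))
    * \prod_(p : party C) meas r (seen_by x a (inr p)) (a (inr p))
         (bas_sub (@is_in W C (carry r) (inr p)) b).

Definition corr (R : realType) (W : wire_kind) (X : theory R W)
  (C : causal_structure) (P : outcomes C -> settings C -> R) : Prop :=
  exists r : realisation X C, forall a x, P a x = prob r a x.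

(* Main.v *)
Require Import Defs.
From mathcomp Require Import all_boot all_order all_algebra all_fingroup.
From mathcomp Require Import boolp reals.

(* Only corr_T <= corr_sT needs an argument.  Replace every state rho emitted by a
   source by the twirled state |G|^-1 sum_g alpha_g(rho) (x) phi_g^(x)k, and every
   instrument and measurement by its encoding.  Since <Q_g, phi_g'> = delta_gg',
   contracting the registers forces the group element read on a wire to be the one
   prepared at its tail.  As the graph is acyclic, once the elements h_s of the
   sources are fixed there is exactly one consistent assignment of group elements to
   the wires, and for it all the maps are conjugated by one and the same tuple
   alpha_g, which cancels along every wire.  So each of the |G|^#sources choices of h
   contributes the original probability. *)

Set Implicit Arguments.
Unset Strict Implicit.
Unset Printing Implicit Defensive.

Import Order.TTheory GRing.Theory Num.Theory.
Local Open Scope ring_scope.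

(** States are known to be preserved only by the collective action, so a source can be twirled only
    with one group element shared by all its wires. A box may nevertheless receive wires from
    several sources, hence carrying different elements; this is why effects and maps are encoded on
    all sectors, with a separate element per input wire. The encodings are invariant because the
    collective action of h turns the summand of g into that of hg and so permutes the summands.
    Expanding all encodings yields summands indexed by one element per source and one element u_x
    per wire, read at its head. Conjugation at a box uses, on an output wire x, the element
    inherited from an input wire, and this need not be u_x. Cancellation along wires is therefore
    available only for consistent u, the fixed points of a propagation map; orthogonality of the
    frame kills the other summands before cancellation is invoked. *)

Lemma bigA_distr_dffun (R : comNzRingType) (I : finType) (T : I -> finType)
    (F : forall i, T i -> R) :
  \prod_i \sum_(t : T i) F i t =
  \sum_(d : {dffun forall i, T i}) \prod_i F i (d i).
Proof.
(* [fprod T] presents dependent functions as functions into tagged pairs, where the non-dependent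
   distributivity law applies. *)
transitivity (\sum_(t : fprod T) \prod_(i in I) ([ffun x => F i x] : {ffun T i -> R}) (t i)).
  rewrite big_fprod -(bigA_distr_big_dep (fun i => tagged_with T i)
    (fun i u => untag 0 [ffun x => F i x] u)).
  apply: eq_bigr => i _.
  rewrite -(big_tag (fun i => ([ffun x => F i x] : {ffun T i -> R}))).
  by apply: eq_bigr=> t _; rewrite ffunE.
rewrite (reindex (@fprod_of_dffun _ T)) /=; last exact/onW_bij/fprod_of_dffun_bij.
apply: eq_bigr => d _; apply: eq_bigr => i _.
by rewrite ffunE fprodE.
Qed.

(** * Fibres of a map *)

Section Fibres.
Variables (R : comNzRingType) (X N : finType) (hd : X -> N).

(** With [hd] the tail or the head of the edge of a wire, the fibres are by conversion the index
    types of [out_sys] and [in_sys]. Products over nodes thus become products over all wires. *)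
Definition fibre n := {x | hd x == n}.

Definition in_fibre x : fibre (hd x) := exist _ x (eqxx (hd x)).

(** Allows a function defined globally, by cases on the node [hd x], to be evaluated at an element
    given in the fibre of a known node. *)
Lemma in_fibreE (T : Type) (f : forall n, fibre n -> T) n (i : fibre n) :
  f (hd (val i)) (in_fibre (val i)) = f n i.
Proof.
case: i => x xn /=.
by case: _ / (eqP xn) (xn) => e; rewrite /in_fibre (eq_irrelevance (eqxx _) e).
Qed.

Lemma prod_fibres (F : forall n, fibre n -> R) :
  \prod_n \prod_(i : fibre n) F n i = \prod_x F (hd x) (in_fibre x).
Proof.
rewrite (sig_big_dep xpredT (fun _ => xpredT) F) /=.
rewrite (reindex (fun x => Tagged fibre (in_fibre x))) //=.
exists (fun u : {n & fibre n} => sval (tagged u)) => [x _ //|[n [x xP]] _ /=].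
by case: _ / (eqP xP) (xP) => e; rewrite /in_fibre (eq_irrelevance (eqxx _) e).
Qed.

(** Fibres partition [X], so independent choices on each fibre amount to one choice on [X]. It
    serves twice: with [D] the basis indices of a wire, and with [D] constantly the group. *)
Lemma sum_fibres (D : X -> finType)
    (F : forall n, {dffun forall i : fibre n, D (val i)} -> R) :
  \prod_n \sum_(d : {dffun forall i : fibre n, D (val i)}) F n d =
  \sum_(a : {dffun forall x, D x})
     \prod_n F n [ffun i => a (val i)].
Proof.
rewrite bigA_distr_dffun.
rewrite (reindex (fun a : {dffun forall x, D x} =>
  [ffun n => [ffun i : fibre n => a (val i)]]
    : {dffun forall n, {dffun forall i : fibre n, D (val i)}})) /=.
  by apply: eq_bigr => a _; apply: eq_bigr => n _; rewrite ffunE.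
exists (fun d : {dffun forall n, {dffun forall i : fibre n, D (val i)}} =>
  [ffun x => (d (hd x) (in_fibre x) : D x)]) => [a _|d _].
  by apply/ffunP=> x; rewrite !ffunE.
apply/ffunP => n; rewrite ffunE; apply/ffunP => -[x xP]; rewrite !ffunE /=.
by case: _ / (eqP xP) (xP) => e; rewrite /in_fibre (eq_irrelevance (eqxx _) e).
Qed.
End Fibres.

(** * Renaming of wires *)

Section Renaming.
Variable W : wire_kind.

(* Systems that agree up to names are compared by a bijection f of the names and
   pointwise equalities of the wires, since adjoining registers commutes with taking
   subsystems only in this sense. *)
Definition pull (S S' : system W) (f : S' -> S)
    (e : forall i, wire_at S' i = wire_at S (f i)) (b : bas S) : bas S' :=
  [ffun i => cast_ord (congr1 (@Defs.dim W) (esym (e i))) (b (f i))].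

(** By functional extensionality [S'] is a [reindex] of [S], and the casts in [pull] become trivial.
    The closure properties of theories, stated for [reindex], thereby reach systems that agree only
    pointwise. *)
Lemma pull_ind (S : system W)
    (P : forall S' : system W, (S' -> S) -> (bas S -> bas S') -> Prop) :
  (forall (I : finType) (f : I -> S), P (Defs.reindex f) f (@bas_reindex W S I f)) ->
  forall (S' : system W) (f : S' -> S) (e : forall i, wire_at S' i = wire_at S (f i)),
    P S' f (pull e).
Proof.
move=> Pf [I w] f e; have ew : w = fun i => wire_at S (f i) by exact/funext.
case: _ / (esym ew) e => e; suff -> : pull e = @bas_reindex W S I f by exact: Pf.
by apply/funext => b; apply/ffunP => i; rewrite !ffunE cast_ord_id.
Qed.

Lemma card_bas (S : system W) : #|bas S| = (\prod_i Defs.dim (wire_at S i))%N.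
Proof.
rewrite card_dep_ffun foldrE big_map big_enum.
by apply: eq_bigr => i _; rewrite card_ord.
Qed.

Lemma bas_reindex_bij (S : system W) (I : finType) (f : I -> S) :
  bijective f -> bijective (@bas_reindex W S I f).
Proof.
(* Counting avoids an explicit inverse, which would need casts between ranges of basis indices. *)
move=> fbij; apply: inj_card_bij => [b b' bb'|].
  apply/ffunP => j; have [g _ gK] := fbij; rewrite -(gK j).
  by have /ffunP/(_ (g j)) := bb'; rewrite !ffunE.
by rewrite !card_bas (reindex f) ?leqnn//; exact: onW_bij.
Qed.

Variables (R : realType) (G : finGroupType) (alpha : waction R W G).

Lemma act_hom_reindex (S : system W) (I : finType) (f : I -> S) (g : G) p :
  bijective f ->
  act_hom alpha (fun=> g) p =
  act_hom alpha (fun=> g) (bas_reindex f p.1, bas_reindex f p.2).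
Proof.
move=> fbij; rewrite !ffunE (reindex f) /=; last exact: onW_bij.
by apply: eq_bigr => i _; rewrite !ffunE.
Qed.

Section Vector.
Variables (S S' : system W) (f : S' -> S).
Hypothesis (e : forall i, wire_at S' i = wire_at S (f i)) (fbij : bijective f).

Definition vec_pull (x : vec R S') : vec R S := [ffun b => x (pull e b)].

Lemma pull_bij : bijective (pull e).
Proof.
apply: (pull_ind (P := fun _ f pl => bijective f -> bijective pl)) e fbij.
exact: bas_reindex_bij.
Qed.

Lemma sum_pull (F : bas S' -> R) : \sum_b F (pull e b) = \sum_b F b.
Proof. by rewrite [RHS](reindex (pull e)) //; exact/onW_bij/pull_bij. Qed.

Lemma act_hom_pull (g : G) b a :
  act_hom alpha (fun=> g) (pull e b, pull e a) = act_hom alpha (fun=> g) (b, a).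
Proof.
apply: (pull_ind (P := fun S' f pl => bijective f -> forall b a,
  act_hom alpha (fun=> g) (pl b, pl a) = act_hom alpha (fun=> g) (b, a)))
  e fbij b a => I h hbij b a.
exact/esym/(act_hom_reindex _ (b, a)).
Qed.

Lemma act_state_pull (g : G) (x : vec R S') :
  act_state alpha (fun=> g) (vec_pull x) = vec_pull (act_state alpha (fun=> g) x).
Proof.
apply/ffunP => b; rewrite !ffunE -sum_pull.
by apply: eq_bigr => a _; rewrite act_hom_pull [vec_pull x a]ffunE.
Qed.

Lemma act_effect_pull (g : G) (x : vec R S') :
  act_effect alpha (fun=> g) (vec_pull x) = vec_pull (act_effect alpha (fun=> g) x).
Proof.
apply/ffunP => b; rewrite !ffunE -sum_pull.
by apply: eq_bigr => a _; rewrite act_hom_pull [vec_pull x a]ffunE.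
Qed.

Variables (T : theory R W) (hT : is_gpt T).

Lemma state_pull (x : vec R S') : state T x -> state T (vec_pull x).
Proof.
apply: (pull_ind (P := fun S' f pl => bijective f -> forall x : vec R S',
  state T x -> state T ([ffun b => x (pl b)] : vec R S))) e fbij x => I h hbij x.
exact: (gpt_state_reindex hT x hbij).1.
Qed.

Lemma effect_pull (x : vec R S') : effect T x -> effect T (vec_pull x).
Proof.
apply: (pull_ind (P := fun S' f pl => bijective f -> forall x : vec R S',
  effect T x -> effect T ([ffun b => x (pl b)] : vec R S))) e fbij x => I h hbij x.
exact: (gpt_effect_reindex hT x hbij).1.
Qed.

Lemma unit_effect_pull : vec_pull (unit_effect T S') = unit_effect T S.
Proof.
apply: (pull_ind (P := fun S' f pl => bijective f ->
  ([ffun b => unit_effect T S' (pl b)] : vec R S) = unit_effect T S))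
  e fbij => I h hbij.
apply/ffunP => b; rewrite !ffunE [RHS](reindex h) /=; last exact: onW_bij.
by apply: eq_bigr => i _; rewrite ffunE.
Qed.

End Vector.

Section Map.
Variables (S1 S1' S2 S2' : system W) (f1 : S1' -> S1) (f2 : S2' -> S2).
Hypothesis (e1 : forall i, wire_at S1' i = wire_at S1 (f1 i)) (f1bij : bijective f1).
Hypothesis (e2 : forall i, wire_at S2' i = wire_at S2 (f2 i)) (f2bij : bijective f2).

Definition hom_pull (F : Defs.hom R S1' S2') : Defs.hom R S1 S2 :=
  [ffun p => F (pull e2 p.1, pull e1 p.2)].

Lemma act_map_pull (g : G) (F : Defs.hom R S1' S2') :
  act_map alpha (fun=> g) (fun=> g) (hom_pull F) =
  hom_pull (act_map alpha (fun=> g) (fun=> g) F).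
Proof.
apply/ffunP => p; rewrite !ffunE /= -(sum_pull e2 f2bij).
apply: eq_bigr => c _; rewrite act_hom_pull // !ffunE -(sum_pull e1 f1bij) /=.
by congr (_ * _); apply: eq_bigr => a _; rewrite ffunE act_hom_pull.
Qed.

Lemma map_class_pull (T : theory R W) (M : map_class R W) (L : finType)
    (l1' : S1' -> L) (l2' : S2' -> L) (l1 : S1 -> L) (l2 : S2 -> L) F :
  closed_map_class T M ->
  (forall i, l1' i = l1 (f1 i)) -> (forall i, l2' i = l2 (f2 i)) ->
  M L S1' S2' l1' l2' F -> M L S1 S2 l1 l2 (hom_pull F).
Proof.
move=> hM /funext -> /funext ->.
apply: (pull_ind (P := fun S1' f1 pl1 => bijective f1 -> forall F : Defs.hom R S1' S2',
    M L S1' S2' (fun i => l1 (f1 i)) (fun i => l2 (f2 i)) F ->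
  M L S1 S2 l1 l2 ([ffun p => F (pull e2 p.1, pl1 p.2)] : Defs.hom R S1 S2)))
  e1 f1bij F => I1 g1 g1bij.
apply: (pull_ind (P := fun S2' f2 pl2 => bijective f2 ->
    forall F : Defs.hom R (Defs.reindex g1) S2',
    M L (Defs.reindex g1) S2' (fun i => l1 (g1 i)) (fun i => l2 (f2 i)) F ->
  M L S1 S2 l1 l2 ([ffun p => F (pl2 p.1, bas_reindex g1 p.2)] : Defs.hom R S1 S2)))
  e2 f2bij => I2 g2 g2bij F.
by move=> /(mc_reindex hM l1 l2 F g1bij g2bij).
Qed.

End Map.
End Renaming.

(** * Composition of linear maps and group actions *)

Section LinearMaps.
Variables (R : realType) (W : wire_kind).

Lemma app_comp (S S' S'' : system W) (F' : Defs.hom R S' S'') (F : Defs.hom R S S') x :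
  app F' (app F x) = app (hom_comp F' F) x.
Proof.
apply/ffunP => b; rewrite !ffunE.
under eq_bigr do rewrite ffunE mulr_sumr.
rewrite exchange_big; apply: eq_bigr => a _ /=.
by rewrite ffunE mulr_suml; apply: eq_bigr => c _; rewrite mulrA.
Qed.

Lemma adjoint_comp (S S' S'' : system W) (F' : Defs.hom R S' S'') (F : Defs.hom R S S') E :
  adjoint F (adjoint F' E) = adjoint (hom_comp F' F) E.
Proof.
apply/ffunP => a; rewrite !ffunE.
under eq_bigr do rewrite ffunE mulr_suml.
rewrite exchange_big; apply: eq_bigr => b _ /=.
by rewrite ffunE mulr_sumr; apply: eq_bigr => c _; rewrite mulrA.
Qed.

Lemma hom_compA (S1 S2 S3 S4 : system W) (F1 : Defs.hom R S3 S4)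
    (F2 : Defs.hom R S2 S3) (F3 : Defs.hom R S1 S2) :
  hom_comp F1 (hom_comp F2 F3) = hom_comp (hom_comp F1 F2) F3.
Proof.
apply/ffunP => p; rewrite !ffunE.
under eq_bigr do rewrite ffunE mulr_sumr.
under [RHS]eq_bigr do rewrite ffunE mulr_suml.
rewrite exchange_big; apply: eq_bigr => a _ /=.
by apply: eq_bigr => c _; rewrite mulrA.
Qed.

Lemma adjoint_sum (S S' : system W) (K : finType) (F : Defs.hom R S S') (E : K -> vec R S') :
  adjoint F (\sum_k E k) = \sum_k adjoint F (E k).
Proof.
apply/ffunP => b; rewrite sum_ffunE !ffunE.
under [RHS]eq_bigr do rewrite ffunE.
rewrite exchange_big; apply: eq_bigr => a _ /=.
by rewrite sum_ffunE mulr_suml.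
Qed.

Lemma hom_comp_suml (S S' S'' : system W) (K : finType) (F' : K -> Defs.hom R S' S'')
    (F : Defs.hom R S S') :
  hom_comp (\sum_k F' k) F = \sum_k hom_comp (F' k) F.
Proof.
apply/ffunP => p; rewrite sum_ffunE !ffunE.
under [RHS]eq_bigr do rewrite ffunE.
rewrite exchange_big; apply: eq_bigr => a _ /=.
by rewrite sum_ffunE mulr_suml.
Qed.

Lemma hom_comp_sumr (S S' S'' : system W) (K : finType) (F' : Defs.hom R S' S'')
    (F : K -> Defs.hom R S S') :
  hom_comp F' (\sum_k F k) = \sum_k hom_comp F' (F k).
Proof.
apply/ffunP => p; rewrite sum_ffunE !ffunE.
under [RHS]eq_bigr do rewrite ffunE.
rewrite exchange_big; apply: eq_bigr => a _ /=.
by rewrite sum_ffunE mulr_sumr.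
Qed.

Variables (G : finGroupType) (alpha : waction R W G).

(** The sum over intermediate product-basis elements factors into one matrix product per wire. *)
Lemma act_hom_comp (S : system W) (g h : S -> G) :
  hom_comp (act_hom alpha g) (act_hom alpha h) =
  act_hom alpha (fun i => (g i * h i)%g).
Proof.
apply/ffunP => p; rewrite !ffunE.
under [LHS]eq_bigr do rewrite !ffunE -big_split /=.
rewrite -(bigA_distr_dffun (fun i c => act_mx alpha (wire_at S i) (g i) (p.1 i) c *
  act_mx alpha (wire_at S i) (h i) c (p.2 i))).
by apply: eq_bigr => i _; rewrite act_mxM mxE.
Qed.

Lemma act_hom1 (S : system W) (g : S -> G) (b a : bas S) :
  (forall i, g i = 1%g) -> act_hom alpha g (b, a) = (b == a)%:R.
Proof.
move=> g1; rewrite ffunE; under eq_bigr do rewrite g1 act_mx1 mxE.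
have [->|/eqP ba] := eqVneq b a; first by rewrite big1// => i _; rewrite eqxx.
have [i /negPf bai] : exists i, b i != a i.
  apply/existsP; apply: contra_notT ba => /existsPn ba.
  by apply/ffunP => i; have /negPn/eqP := ba i.
by rewrite (bigD1 i) //= bai mul0r.
Qed.

Lemma act_effectM (S : system W) (g h : S -> G) E :
  act_effect alpha g (act_effect alpha h E) = act_effect alpha (fun i => (g i * h i)%g) E.
Proof.
rewrite /act_effect adjoint_comp act_hom_comp.
by congr (adjoint (act_hom _ _) _); apply/funext => i; rewrite invMg.
Qed.

Lemma act_stateM (S : system W) (g h : S -> G) x :
  act_state alpha g (act_state alpha h x) = act_state alpha (fun i => (g i * h i)%g) x.
Proof. by rewrite /act_state app_comp act_hom_comp. Qed.

Lemma act_mapM (S S' : system W) (g h : S -> G) (g' h' : S' -> G) F :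
  act_map alpha g g' (act_map alpha h h' F) =
  act_map alpha (fun i => (g i * h i)%g) (fun i => (g' i * h' i)%g) F.
Proof.
rewrite /act_map !hom_compA act_hom_comp -!hom_compA act_hom_comp.
congr (hom_comp _ (hom_comp _ _)).
by congr act_hom; apply/funext => i; rewrite invMg.
Qed.

End LinearMaps.

(** * Systems with registers *)

Section Enlarge.
Variables (R : realType) (W : wire_kind) (r : system W).

Definition join (S : system W) (b : bas S) (c : {ffun S -> bas r}) : bas (enlarge r S) :=
  [ffun x => match x as x return 'I_(Defs.dim (wire_at (enlarge r S) x)) with
             | inl i => b i
             | inr y => c y.1 y.2
             end].

Lemma bas_wires_join S (b : bas S) c : bas_wires (join b c) = b.
Proof. by apply/ffunP => i; rewrite !ffunE. Qed.

Lemma bas_register_join S (b : bas S) c i : bas_register (join b c) i = c i.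
Proof. by apply/ffunP => j; rewrite !ffunE. Qed.

Lemma sum_enlarge S (F : bas (enlarge r S) -> R) :
  \sum_b F b = \sum_b \sum_c F (join b c).
Proof.
rewrite pair_big (reindex (fun p : bas S * {ffun S -> bas r} => join p.1 p.2)) //.
exists (fun b => (bas_wires b, [ffun i => bas_register b i])) => [[b c] _|b _] /=.
  congr (_, _); first exact: bas_wires_join.
  by apply/ffunP => i; rewrite ffunE bas_register_join.
by apply/ffunP => -[i|[i j]]; rewrite !ffunE.
Qed.

Lemma sum_enlarge_prod S (k0 : bas S -> R) (k : S -> bas r -> R) :
  \sum_(a : bas (enlarge r S)) k0 (bas_wires a) * \prod_i k i (bas_register a i) =
  (\sum_a k0 a) * \prod_i \sum_c k i c.
Proof.
rewrite sum_enlarge bigA_distr_bigA mulr_suml; apply: eq_bigr => b _.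
rewrite mulr_sumr; apply: eq_bigr => c _; rewrite bas_wires_join.
by congr (_ * _); apply: eq_bigr => i _; rewrite bas_register_join.
Qed.

(** Product vectors with one register vector per wire. Each sector of an encoding has this form, or
    that of [enlarge_hom], whose register part is measure-and-prepare. *)
Definition enlarge_vec S (x : vec R S) (y : S -> vec R r) : vec R (enlarge r S) :=
  [ffun b => x (bas_wires b) * \prod_i y i (bas_register b i)].

Definition enlarge_hom S S' (F : Defs.hom R S S') (y : S -> vec R r) (z : S' -> vec R r) :
    Defs.hom R (enlarge r S) (enlarge r S') :=
  [ffun p => F (bas_wires p.1, bas_wires p.2)
    * (\prod_i y i (bas_register p.2 i)) * \prod_j z j (bas_register p.1 j)].

Variables (G : finGroupType) (alpha : waction R W G).

Lemma act_hom_enlarge S (g : G) (b a : bas (enlarge r S)) :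
  act_hom alpha (fun=> g) (b, a) = act_hom alpha (fun=> g) (bas_wires b, bas_wires a)
    * \prod_i act_hom alpha (fun=> g) (bas_register b i, bas_register a i).
Proof.
rewrite !ffunE big_sumType /=; congr (_ * _).
  by apply: eq_bigr => i _; rewrite !ffunE.
under [RHS]eq_bigr do rewrite ffunE.
by rewrite pair_big; apply: eq_bigr => -[i j] _; rewrite !ffunE.
Qed.

Lemma app_enlarge S (g : G) (x : vec R S) y :
  app (act_hom alpha (fun=> g)) (enlarge_vec x y) =
  enlarge_vec (app (act_hom alpha (fun=> g)) x)
    (fun i => app (act_hom alpha (fun=> g)) (y i)).
Proof.
apply/ffunP => b; rewrite !ffunE.
under [in RHS]eq_bigr do rewrite ffunE.
rewrite -(sum_enlarge_prod
  (fun a => act_hom alpha (fun=> g) (bas_wires b, a) * x a)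
  (fun i c => act_hom alpha (fun=> g) (bas_register b i, c) * y i c)).
apply: eq_bigr => a _; rewrite act_hom_enlarge big_split /= [enlarge_vec _ _ _]ffunE.
by rewrite mulrACA.
Qed.

Lemma adjoint_enlarge S (g : G) (x : vec R S) y :
  adjoint (act_hom alpha (fun=> g)) (enlarge_vec x y) =
  enlarge_vec (adjoint (act_hom alpha (fun=> g)) x)
    (fun i => adjoint (act_hom alpha (fun=> g)) (y i)).
Proof.
apply/ffunP => b; rewrite !ffunE.
under [in RHS]eq_bigr do rewrite ffunE.
rewrite -(sum_enlarge_prod
  (fun a => x a * act_hom alpha (fun=> g) (a, bas_wires b))
  (fun i c => y i c * act_hom alpha (fun=> g) (c, bas_register b i))).
apply: eq_bigr => a _; rewrite act_hom_enlarge big_split /= [enlarge_vec _ _ _]ffunE.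
by rewrite mulrACA.
Qed.

(** On the registers the map pairs its input with [y] and prepares [z]. Conjugation therefore moves
    [y] contragrediently, through precomposition with the inverse, and [z] as a state, through
    postcomposition. *)
Lemma act_map_enlarge S S' (g : G) (F : Defs.hom R S S') y z :
  act_map alpha (fun=> g) (fun=> g) (enlarge_hom F y z) =
  enlarge_hom (act_map alpha (fun=> g) (fun=> g) F)
    (fun i => act_effect alpha (fun=> g) (y i))
    (fun j => act_state alpha (fun=> g) (z j)).
Proof.
have right_enlarge :
    hom_comp (enlarge_hom F y z) (act_hom alpha (fun=> g^-1%g)) =
    enlarge_hom (hom_comp F (act_hom alpha (fun=> g^-1%g)))
      (fun i => act_effect alpha (fun=> g) (y i)) z.
  apply/ffunP => -[b a]; rewrite !ffunE /=.
  under [X in _ * X * _]eq_bigr do rewrite ffunE.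
  rewrite -(sum_enlarge_prod
    (fun c => F (bas_wires b, c) * act_hom alpha (fun=> g^-1%g) (c, bas_wires a))
    (fun i c => y i c * act_hom alpha (fun=> g^-1%g) (c, bas_register a i))).
  rewrite mulr_suml; apply: eq_bigr => c _.
  rewrite act_hom_enlarge big_split /= [enlarge_hom _ _ _ _]ffunE /=.
  by rewrite mulrAC mulrACA.
rewrite /act_map right_enlarge; apply/ffunP => -[b a]; rewrite !ffunE /=.
under [X in _ * X]eq_bigr do rewrite ffunE.
rewrite mulrAC -(sum_enlarge_prod
  (fun c => act_hom alpha (fun=> g) (bas_wires b, c) *
    hom_comp F (act_hom alpha (fun=> g^-1%g)) (c, bas_wires a))
  (fun i c => act_hom alpha (fun=> g) (bas_register b i, c) * z i c)).
rewrite mulr_suml; apply: eq_bigr => c _.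
rewrite act_hom_enlarge big_split /= [enlarge_hom _ _ _ _]ffunE /=.
by rewrite -!mulrA; congr (_ * _); rewrite mulrCA; do 2!congr (_ * _); rewrite mulrC.
Qed.

End Enlarge.

(** * Encodings *)

Section Encoding.
Variables (R : realType) (W : wire_kind) (T : theory R W).
Variables (G : finGroupType) (alpha : waction R W G).
Hypotheses (hT : is_gpt T) (hG : is_symmetry alpha T).

Lemma pairing_adjoint (S S' : system W) (F : Defs.hom R S S') E x :
  pairing (adjoint F E) x = pairing E (app F x).
Proof.
rewrite /pairing; under eq_bigr do rewrite ffunE mulr_suml.
rewrite exchange_big; apply: eq_bigr => b _ /=.
by rewrite ffunE mulr_sumr; apply: eq_bigr => a _; rewrite mulrA.
Qed.

Lemma act_effect_unit_prod (S : system W) (g : S -> G) a :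
  act_effect alpha g (unit_effect T S) a =
  \prod_i (unit_wire T (wire_at S i) *m act_mx alpha (wire_at S i) (g i)^-1%g) 0 (a i).
Proof.
rewrite ffunE; under [LHS]eq_bigr do rewrite !ffunE -big_split /=.
rewrite -(bigA_distr_dffun (fun i c => unit_wire T (wire_at S i) 0 c *
  act_mx alpha (wire_at S i) (g i)^-1%g c (a i))).
by apply: eq_bigr => i _; rewrite mxE.
Qed.

(* Only the collective action is known to preserve states, so the invariance of
   the unit is read off a system made of one wire. *)
Lemma unit_wire_act (w : W) (g : G) :
  unit_wire T w *m act_mx alpha w g^-1%g = unit_wire T w.
Proof.
pose S := @Sys W unit (fun=> w).
have unitS : act_effect alpha (fun=> g) (unit_effect T S) = unit_effect T S.
  apply: (gpt_effect_tomo hT).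
  - exact/(sym_effect hG)/(gpt_effect_unit hT).
  - exact: (gpt_effect_unit hT).
  move=> rho rhoT; rewrite pairing_adjoint !(gpt_state_norm hT) //.
  exact: (sym_state hG g^-1%g).
apply/rowP => j; have /ffunP/(_ [ffun=> j]) := unitS.
by rewrite act_effect_unit_prod ffunE !(big_pred1 tt) ?ffunE // => -[].
Qed.

(** Arbitrary tuples are allowed because invariance holds wire by wire; the sectors of an encoded
    unit run over all tuples. *)
Lemma act_effect_unit (S : system W) (g : S -> G) :
  act_effect alpha g (unit_effect T S) = unit_effect T S.
Proof.
apply/ffunP => a; rewrite act_effect_unit_prod ffunE.
by apply: eq_bigr => i _; rewrite unit_wire_act.
Qed.

Lemma state_avg (S : system W) (I : Type) (s : seq I) (x : I -> vec R S) :
  (0 < size s)%N -> (forall i, state T (x i)) ->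
  state T [ffun b => (size s)%:R^-1 * \sum_(i <- s) x i b].
Proof.
move=> s0 xT; elim: s s0 => // i [_ _|j s IHs _].
  suff -> : [ffun b => 1%:R^-1 * \sum_(k <- [:: i]) x k b] = x i by [].
  by apply/ffunP => b; rewrite ffunE big_seq1 invr1 mul1r.
set n := size (j :: s).
have n0 : (0 : R) < n%:R by rewrite ltr0n.
have m0 : (0 : R) < n.+1%:R by rewrite ltr0n.
(* The new state gets weight 1/(n+1), the average of the other n states the remaining n/(n+1). *)
have := gpt_state_convex hT (t := n.+1%:R^-1) _ _ (xT i) (IHs isT).
rewrite invr_ge0 (ltW m0) invf_le1 // ler1n => /(_ isT isT).
congr (state T _); apply/ffunP => b; rewrite !ffunE [in RHS]big_cons [RHS]mulrDr; congr (_ + _).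
rewrite mulrA; congr (_ * _).
have -> : (1 - n.+1%:R^-1 : R) = n%:R * n.+1%:R^-1.
  by rewrite -[n in RHS]/(n.+1.-1) -subn1 natrB // mulrBl divff ?gt_eqF // mul1r.
by rewrite mulrAC divff ?gt_eqF // mul1r.
Qed.

Variables (r : system W) (phi Q : G -> vec R r).
Hypothesis H1 : reference_frame alpha T phi Q.

(* Registers are adjoined one at a time to an existing state, as the system
   without wires need not have a state. *)
Lemma state_tens_copies (S : system W) (x : vec R S) (y : vec R r) k :
  state T x -> state T y ->
  state T ([ffun b => x (bas_l b) * \prod_(i < k) y (bas_copy (bas_r b) i)]
    : vec R (tens S (copies k r))).
Proof.
move=> xT yT; elim: k => [|k IHk].
  pose f (i : S) : tens S (copies 0 r) := inl i.
  have e i : wire_at S i = wire_at (tens S (copies 0 r)) (f i) by [].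
  have fbij : bijective f.
    apply: inj_card_bij => [i j []//|].
    by rewrite card_sum card_prod card_ord mul0n addn0.
  have := state_pull e fbij hT xT; congr (state T _).
  apply/ffunP => b; rewrite !ffunE big_ord0 mulr1; congr (x _).
  by apply/ffunP => i; rewrite !ffunE cast_ord_id.
(* The register adjoined last becomes copy 0 and the others are shifted up, to match the expansion
   of the product by [big_ord_recl]. *)
pose f (i : tens (tens S (copies k r)) r) : tens S (copies k.+1 r) :=
  match i with
  | inl (inl i) => inl i
  | inl (inr (m, j)) => inr (lift ord0 m, j)
  | inr j => inr (ord0, j)
  end.
have e i : wire_at (tens (tens S (copies k r)) r) i =
    wire_at (tens S (copies k.+1 r)) (f i) by case: i => [[i|[m j]]|j].
have fbij : bijective f.
  apply: inj_card_bij => [|].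
    case=> [[i|[m j]]|j] [[i'|[m' j']]|j'] //=.
    - by case=> ->.
    - by case=> emm ->; congr (inl (inr (_, _))); exact: val_inj.
    - by case=> ->.
  by rewrite !card_sum !card_prod !card_ord mulSn -addnA leq_add2l addnC.
have := state_pull e fbij hT (gpt_state_tens hT IHk yT); congr (state T _).
apply/ffunP => b; rewrite !ffunE big_ord_recl -mulrA [X in _ = _ * X]mulrC.
congr (x _ * (_ * y _)).
- by apply/ffunP => i; rewrite !ffunE cast_ord_id.
- apply: eq_bigr => m _; congr (y _).
  by apply/ffunP => j; rewrite !ffunE cast_ord_id.
- by apply/ffunP => j; rewrite !ffunE cast_ord_id.
Qed.

Lemma state_enlarge (S : system W) (x : vec R S) (y : vec R r) :
  state T x -> state T y -> state T (enlarge_vec x (fun=> y)).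
Proof.
move=> xT yT.
pose f (i : tens S (copies #|S| r)) : enlarge r S :=
  match i with inl i => inl i | inr (m, j) => inr (enum_val m, j) end.
have e i : wire_at (tens S (copies #|S| r)) i = wire_at (enlarge r S) (f i).
  by case: i => [i|[m j]].
have fbij : bijective f.
  apply: inj_card_bij => [[i|[m j]] [i'|[m' j']] //=|].
  - by case=> ->.
  - by case=> /enum_val_inj -> ->.
  by rewrite !card_sum !card_prod card_ord.
have := state_pull e fbij hT (state_tens_copies #|S| xT yT); congr (state T _).
apply/ffunP => b; rewrite !ffunE; congr (x _ * _).
  by apply/ffunP => i; rewrite !ffunE cast_ord_id.
rewrite [RHS](reindex (fun m : 'I_#|S| => enum_val m)) /=; last first.
  exact/onW_bij/enum_val_bij.
apply: eq_bigr => m _; congr (y _).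
by apply/ffunP => j; rewrite !ffunE cast_ord_id.
Qed.

(** * Invariance and normalisation of encoded states, effects and maps *)

Definition encode_state (S : system W) (x : vec R S) : vec R (enlarge r S) :=
  [ffun b => #|G|%:R^-1 *
     \sum_g enlarge_vec (act_state alpha (fun=> g) x) (fun=> phi g) b].

Lemma encode_state_sub (S : system W) (x : vec R S) :
  state T x -> state (subtheory alpha T) (encode_state x).
Proof.
move=> xT; split=> [|h].
  have cG : (0 < size (enum G))%N by rewrite -cardE; apply/card_gt0P; exists 1%g.
  have := state_avg cG (fun g => state_enlarge (sym_state hG g xT) (frame_state H1 g)).
  congr (state T _); apply/ffunP => b.
  by rewrite [LHS]ffunE [RHS]ffunE -cardE big_enum.
apply/ffunP => b; rewrite 2!ffunE.
under eq_bigr do rewrite [encode_state x _]ffunE mulrCA mulr_sumr.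
rewrite -mulr_sumr exchange_big; congr (_ * _).
rewrite [RHS](reindex_inj (mulgI h)); apply: eq_bigr => g _.
have := app_enlarge alpha h (act_state alpha (fun=> g) x) (fun=> phi g).
rewrite [app _ (act_state _ _ _)]act_stateM => /ffunP/(_ b).
rewrite ffunE => ->; congr (enlarge_vec _ _ b).
by apply/funext => i; exact: (frame_act_state H1).
Qed.

Lemma encode_effectE (S : system W) (E : vec R S) :
  encode_effect alpha Q E =
  \sum_(g : {ffun idx S -> G}) enlarge_vec (act_effect alpha g E) (fun i => Q (g i)).
Proof.
by apply/ffunP => b; rewrite sum_ffunE ffunE; apply: eq_bigr => g _; rewrite [RHS]ffunE.
Qed.

Lemma encode_mapE (S S' : system W) (from : S' -> S) (F : Defs.hom R S S') :
  encode_map alpha phi Q from F =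
  \sum_(g : {ffun idx S -> G}) enlarge_hom (act_map alpha g (fun j => g (from j)) F)
    (fun i => Q (g i)) (fun j => phi (g (from j))).
Proof.
by apply/ffunP => b; rewrite sum_ffunE ffunE; apply: eq_bigr => g _; rewrite [RHS]ffunE.
Qed.

(** The reindexing of sectors that absorbs the collective action of [h] on encoded effects and
    maps. *)
Lemma translation_bij (I : finType) (h : G) :
  bijective (fun g : {ffun I -> G} => [ffun i => (h * g i)%g]).
Proof.
exists (fun g : {ffun I -> G} => [ffun i => (h^-1 * g i)%g]) => g;
  by apply/ffunP => i; rewrite !ffunE ?mulKg ?mulKVg.
Qed.

Lemma act_encode_effect (S : system W) (E : vec R S) h :
  act_effect alpha (fun=> h) (encode_effect alpha Q E) = encode_effect alpha Q E.
Proof.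
rewrite encode_effectE [LHS]adjoint_sum.
rewrite [RHS](reindex _ (onW_bij _ (translation_bij S h))) /=.
apply: eq_bigr => g _; rewrite adjoint_enlarge.
congr enlarge_vec.
  by rewrite [LHS]act_effectM; congr act_effect; apply/funext => i; rewrite ffunE.
by apply/funext => i; rewrite ffunE -(frame_act_effect H1).
Qed.

Lemma act_map_sum (S S' : system W) (K : finType) (g : S -> G) (g' : S' -> G)
    (F : K -> Defs.hom R S S') :
  act_map alpha g g' (\sum_k F k) = \sum_k act_map alpha g g' (F k).
Proof. by rewrite /act_map hom_comp_suml hom_comp_sumr. Qed.

Lemma encode_map_sum (S S' : system W) (from : S' -> S) (K : finType)
    (F : K -> Defs.hom R S S') :
  encode_map alpha phi Q from (\sum_k F k) = \sum_k encode_map alpha phi Q from (F k).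
Proof.
apply/ffunP => p; rewrite sum_ffunE ffunE.
under [RHS]eq_bigr do rewrite ffunE.
rewrite exchange_big; apply: eq_bigr => g _ /=.
by rewrite act_map_sum sum_ffunE -!mulr_suml.
Qed.

Lemma act_encode_map (S S' : system W) (from : S' -> S) (F : Defs.hom R S S') :
  invariant_map alpha (encode_map alpha phi Q from F).
Proof.
move=> h; rewrite encode_mapE act_map_sum.
rewrite [RHS](reindex _ (onW_bij _ (translation_bij S h))) /=.
apply: eq_bigr => g _; rewrite act_map_enlarge act_mapM.
congr enlarge_hom; first by congr act_map; apply/funext => i; rewrite ffunE.
  by apply/funext => i; rewrite ffunE (frame_act_effect H1).
by apply/funext => i; rewrite ffunE (frame_act_state H1).
Qed.

(** Every tuple fixes the unit, so the sum over sectors bears on the registers alone and factors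
    over them; in each register the [Q g] sum to the unit. *)
Lemma encode_unit (S : system W) :
  encode_effect alpha Q (unit_effect T S) = unit_effect T (enlarge r S).
Proof.
apply/ffunP => b; rewrite ffunE.
under eq_bigr do rewrite act_effect_unit.
rewrite -mulr_sumr -(bigA_distr_bigA (fun i g => Q g (bas_register b i))).
rewrite [RHS]ffunE big_sumType; congr (_ * _) => /=.
  by rewrite ffunE; apply: eq_bigr => i _; rewrite ffunE.
transitivity (\prod_(i : S) \prod_(j : r) unit_wire T (wire_at r j) 0 (b (inr (i, j)))).
  apply: eq_bigr => i _; rewrite -sum_ffunE (frame_measurement H1).2 ffunE.
  by apply: eq_bigr => j _; rewrite ffunE.
by rewrite pair_big; apply: eq_bigr => -[i j].
Qed.

Hypothesis H4 : encodings_admitted alpha T phi Q.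

Lemma encode_effect_sub (S : system W) (E : vec R S) :
  effect T E -> effect (subtheory alpha T) (encode_effect alpha Q E).
Proof. by move=> ET; split=> [|h]; [exact: enc_effect H4 _ _ ET|exact: act_encode_effect]. Qed.

Lemma sum_encode_effect (S : system W) (K : finType) (E : K -> vec R S) :
  \sum_k encode_effect alpha Q (E k) = encode_effect alpha Q (\sum_k E k).
Proof.
apply/ffunP => p; rewrite sum_ffunE ffunE.
under [LHS]eq_bigr do rewrite ffunE.
rewrite exchange_big; apply: eq_bigr => g _ /=.
by rewrite /act_effect adjoint_sum sum_ffunE mulr_suml.
Qed.

End Encoding.

(** * Networks *)

(** Tails lie in [source + box] and heads in [box + party], and the two kinds of node contribute
    factors of different shapes; hence a separate product for each summand. *)
Lemma sum_fibres_sum (R : comNzRingType) (X N1 N2 : finType) (hd : X -> (N1 + N2)%type)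
    (D : X -> finType)
    (F1 : forall n, {dffun forall i : fibre hd (inl n), D (val i)} -> R)
    (F2 : forall n, {dffun forall i : fibre hd (inr n), D (val i)} -> R) :
  (\prod_n \sum_d F1 n d) * (\prod_n \sum_d F2 n d) =
  \sum_(a : {dffun forall x, D x})
     (\prod_n F1 n [ffun i => a (val i)]) * \prod_n F2 n [ffun i => a (val i)].
Proof.
pose F n : {dffun forall i : fibre hd n, D (val i)} -> R :=
  match n with inl n => F1 n | inr n => F2 n end.
have := sum_fibres F; rewrite big_sumType /= => ->.
by apply: eq_bigr => a _; rewrite big_sumType.
Qed.

Lemma prod_fibres_sum (R : comNzRingType) (X N1 N2 : finType) (hd : X -> (N1 + N2)%type)
    (F1 : forall n, fibre hd (inl n) -> R) (F2 : forall n, fibre hd (inr n) -> R) :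
  (\prod_n \prod_i F1 n i) * (\prod_n \prod_i F2 n i) =
  \prod_x match hd x as n return fibre hd n -> R with
          | inl n => F1 n
          | inr n => F2 n
          end (in_fibre hd x).
Proof.
pose F n : fibre hd n -> R := match n with inl n => F1 n | inr n => F2 n end.
by have := prod_fibres F; rewrite big_sumType.
Qed.

Lemma prod_fibres_val (R : comNzRingType) (X N1 N2 : finType) (hd : X -> (N1 + N2)%type)
    (f : X -> R) :
  (\prod_n \prod_(i : fibre hd (inl n)) f (val i)) *
  (\prod_n \prod_(i : fibre hd (inr n)) f (val i)) = \prod_x f x.
Proof.
rewrite (prod_fibres_sum (fun n i => f (val i)) (fun n i => f (val i))).
apply: eq_bigr => x _; rewrite -[X in _ = f X]/(val (in_fibre hd x)).
by case: (hd x) (in_fibre hd x).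
Qed.

(** * Unique propagation along a ranked dependence *)

Section FixedPoint.
Variables (X : finType) (V : eqType) (v0 : V) (rank : X -> nat).
Variable Phi : {ffun X -> V} -> {ffun X -> V}.
Hypothesis Phi_rank : forall (x : X) (u v : {ffun X -> V}),
  (forall y, (rank y < rank x)%N -> u y = v y) -> Phi u x = Phi v x.

(** After n iterations the values at ranks below n no longer depend on the starting point, so
    iterating beyond the largest rank gives a constant, which is the fixed point. The boolean form
    allows rewriting an indicator inside a sum. *)
Lemma unique_fixed_point : exists u0, forall u, (u == Phi u) = (u == u0).
Proof.
have iter_rank n u v x : (rank x < n)%N -> iter n Phi u x = iter n Phi v x.
  elim: n x => // n IHn x xn /=; apply: Phi_rank => y yx.
  by apply: IHn; apply: leq_trans yx _.
pose n := (\max_x rank x).+1.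
have iterC u v : iter n Phi u = iter n Phi v.
  by apply/ffunP => x; apply: iter_rank; rewrite ltnS (leq_bigmax x).
exists (iter n Phi [ffun=> v0]) => u; apply/eqP/eqP => [uP|->].
  have fixu m : iter m Phi u = u by elim: m => //= m ->; rewrite -uP.
  by rewrite (iterC _ u) fixu.
by rewrite -iterS iterSr; exact: iterC.
Qed.

End FixedPoint.

(** The rank counts ancestors, each node being its own ancestor: those of [x] are among those of
    [y], while [y] itself is not an ancestor of [x]. *)
Lemma acyclic_rank (V : finType) (e : rel V) : acyclic e ->
  forall x y, e x y -> (#|[pred z | connect e z x]| < #|[pred z | connect e z y]|)%N.
Proof.
move=> eac x y exy; apply: proper_card; apply/properP; split.
  by apply/subsetP => z /connect_trans; apply; exact: connect1.
by exists y; [exact: connect0|exact: eac].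
Qed.

Section Network.
Variables (R : realType) (W : wire_kind) (C : causal_structure).
Variables (G : finGroupType) (alpha : waction R W G).
Variable carry : edge C -> system W.

Notation X := (idx (all_wires carry)).
Notation out t := (out_sys carry t).
Notation inn n := (in_sys carry n).
Notation sub_out t b := (bas_sub (@is_out W C carry t) b).
Notation sub_in n b := (bas_sub (@is_in W C carry n) b).

(** The contraction in [prob], freed from membership in a theory: it must also apply to components
    transformed by non-collective tuples, which need not be states. *)
Definition network (carry : edge C -> system W)
    (rho : forall s, vec R (out_sys carry (inl s)))
    (F : forall v, Defs.hom R (in_sys carry (inl v)) (out_sys carry (inr v)))
    (E : forall p, vec R (in_sys carry (inr p))) : R :=
  \sum_(b : bas (all_wires carry))
    (\prod_s rho s (bas_sub (@is_out W C carry (inl s)) b))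
    * (\prod_v F v (bas_sub (@is_out W C carry (inr v)) b,
                    bas_sub (@is_in W C carry (inl v)) b))
    * \prod_p E p (bas_sub (@is_in W C carry (inr p)) b).

Lemma act_hom_out (g : X -> G) (b a : bas (all_wires carry)) :
  (\prod_s act_hom alpha (fun i : out (inl s) => g (val i))
     (sub_out (inl s) b, sub_out (inl s) a)) *
  (\prod_v act_hom alpha (fun i : out (inr v) => g (val i))
     (sub_out (inr v) b, sub_out (inr v) a)) = act_hom alpha g (b, a).
Proof.
rewrite ffunE -(prod_fibres_val (fun x : X => Defs.tail (tag x))).
congr (_ * _); apply: eq_bigr => n _; rewrite ffunE;
  by apply: eq_bigr => i _; rewrite !ffunE.
Qed.

Lemma act_hom_in (g : X -> G) (b a : bas (all_wires carry)) :
  (\prod_v act_hom alpha (fun i : inn (inl v) => g (val i))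
     (sub_in (inl v) b, sub_in (inl v) a)) *
  (\prod_p act_hom alpha (fun i : inn (inr p) => g (val i))
     (sub_in (inr p) b, sub_in (inr p) a)) = act_hom alpha g (b, a).
Proof.
rewrite ffunE -(prod_fibres_val (fun x : X => Defs.head (tag x))).
congr (_ * _); apply: eq_bigr => n _; rewrite ffunE;
  by apply: eq_bigr => i _; rewrite !ffunE.
Qed.

Notation res_out t g := (fun i : out t => g (val i)).
Notation res_in n g := (fun i : inn n => g (val i)).

Variable rho : forall s, vec R (out (inl s)).
Variable F : forall v, Defs.hom R (inn (inl v)) (out (inr v)).
Variable E : forall p, vec R (inn (inr p)).

(* The factors alpha_g at the tail and alpha_g^-1 at the head of each wire cancel. *)
Lemma network_act (g : X -> G) :
  network (fun s => act_state alpha (res_out (inl s) g) (rho s))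
    (fun v => act_map alpha (res_in (inl v) g) (res_out (inr v) g) (F v))
    (fun p => act_effect alpha (res_in (inr p) g) (E p)) = network rho F E.
Proof.
pose D (x : X) : finType := 'I_(Defs.dim (wire_at (all_wires carry) x)).
pose A b a := act_hom alpha g (b, a).
pose A' b a := act_hom alpha (fun x => (g x)^-1%g) (b, a).
(* Each wire receives three indices: [a] at its tail before alpha_g, [b] between alpha_g and its
   inverse, [a'] at its head. Summing over [b] first will identify [a] and [a']. *)
transitivity (\sum_b \sum_a \sum_a'
   (\prod_s rho s (sub_out (inl s) a)
    * \prod_v F v (sub_out (inr v) a, sub_in (inl v) a')
    * \prod_p E p (sub_in (inr p) a')) * (A' a' b * A b a)).
  apply: eq_bigr => b _.
  have -> : (\prod_s act_state alpha (res_out (inl s) g) (rho s) (sub_out (inl s) b)) =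
    \prod_s \sum_(d : bas (out (inl s)))
      act_hom alpha (res_out (inl s) g) (sub_out (inl s) b, d) * rho s d.
    by apply: eq_bigr => s _; rewrite ffunE.
  have -> : (\prod_v act_map alpha (res_in (inl v) g) (res_out (inr v) g) (F v)
        (sub_out (inr v) b, sub_in (inl v) b)) =
    \prod_v \sum_(d : bas (out (inr v)))
      act_hom alpha (res_out (inr v) g) (sub_out (inr v) b, d) *
      \sum_(d' : bas (inn (inl v))) F v (d, d') *
        act_hom alpha (fun i : inn (inl v) => (g (val i))^-1%g) (d', sub_in (inl v) b).
    apply: eq_bigr => v _; rewrite ffunE; apply: eq_bigr => d _.
    by rewrite [in RHS]/= [in LHS]/=; congr (_ * _); rewrite [LHS]ffunE.
  have -> : (\prod_p act_effect alpha (res_in (inr p) g) (E p) (sub_in (inr p) b)) =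
    \prod_p \sum_(d : bas (inn (inr p)))
      E p d * act_hom alpha (fun i : inn (inr p) => (g (val i))^-1%g) (d, sub_in (inr p) b).
    by apply: eq_bigr => p _; rewrite ffunE.
  rewrite (sum_fibres_sum (hd := fun x : X => Defs.tail (tag x)) (D := D)
    (fun s d => act_hom alpha (res_out (inl s) g) (sub_out (inl s) b, d) * rho s d)).
  rewrite mulr_suml; apply: eq_bigr => a _.
  rewrite !big_split /= [X in X * _ = _]mulrACA act_hom_out -/(A b a).
  rewrite -!mulrA.
  rewrite (sum_fibres_sum (hd := fun x : X => Defs.head (tag x)) (D := D)
    (fun v d' => F v (sub_out (inr v) a, d') *
        act_hom alpha (fun i : inn (inl v) => (g (val i))^-1%g) (d', sub_in (inl v) b))
    (fun p d => E p d *
        act_hom alpha (fun i : inn (inr p) => (g (val i))^-1%g) (d, sub_in (inr p) b))).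
  rewrite !mulr_sumr; apply: eq_bigr => a' _.
  rewrite !big_split /= [X in _ * (_ * X) = _]mulrACA.
  rewrite (act_hom_in (fun x => (g x)^-1%g)) -/(A' a' b).
  by rewrite [LHS]mulrC -!mulrA.
rewrite exchange_big; apply: eq_bigr => a _ /=.
have AA a' : \sum_b A' a' b * A b a = (a' == a)%:R.
  have := act_hom_comp alpha (fun x => (g x)^-1%g) g.
  move=> /ffunP/(_ (a', a)); rewrite ffunE => ->.
  by apply: act_hom1 => x; rewrite mulVg.
rewrite exchange_big (bigD1 a) //= [X in _ + X]big1 ?addr0 => [|a' /negPf a'a];
  by rewrite -mulr_sumr AA ?eqxx ?a'a ?mulr1 ?mulr0.
Qed.

(** * Propagation of group elements and contraction of the registers *)

Variables (r : system W) (phi Q : G -> vec R r).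
Hypothesis phiQ : forall g g', pairing (Q g) (phi g') = (g == g')%:R.
Variable from : forall v, out (inr v) -> inn (inl v).

(* The group element prepared in the register of each wire at its tail, when h is drawn
   at the sources and u is read at the heads. *)
Definition emitted (h : {ffun source C -> G}) (u : {ffun X -> G}) : {ffun X -> G} :=
  [ffun x => match Defs.tail (tag x) as t
                   return fibre (fun x : X => Defs.tail (tag x)) t -> G with
             | inl s => fun=> h s
             | inr v => fun i => u (val (from i))
             end (in_fibre (fun x : X => Defs.tail (tag x)) x)].

Lemma emitted_source h u s (i : out (inl s)) : emitted h u (val i) = h s.
Proof.
rewrite ffunE; apply: (in_fibreE (hd := fun x : X => Defs.tail (tag x))
  (fun t => match t return fibre _ t -> G with
            | inl s => fun=> h s | inr v => fun i => u (val (from i)) end)).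
Qed.

Lemma emitted_box h u v (i : out (inr v)) : emitted h u (val i) = u (val (from i)).
Proof.
rewrite ffunE; apply: (in_fibreE (hd := fun x : X => Defs.tail (tag x))
  (fun t => match t return fibre _ t -> G with
            | inl s => fun=> h s | inr v => fun i => u (val (from i)) end)).
Qed.

Lemma emitted_fixed_point h : exists u0, forall u, (u == emitted h u) = (u == u0).
Proof.
have := acyclic_rank (@causal_acyclic C); set e := (fun _ _ => _) => e_rank.
(* An output of a box depends on one of its inputs, which leaves either a source, at rank 0, or a
   box with fewer ancestors. The successor makes the comparison with source wires immediate. *)
pose rank (x : X) := if Defs.tail (tag x) is inr v
  then (#|[pred z | connect e z (inl v)]|).+1 else 0.
apply: (unique_fixed_point (1%g : G) (rank := rank)) => x u v uv.
case tx : (Defs.tail (tag x)) => [s|w].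
  pose i : out (inl s) := exist _ x (introT eqP tx).
  exact: etrans (emitted_source h u i) (esym (emitted_source h v i)).
pose i : out (inr w) := exist _ x (introT eqP tx).
apply: etrans (emitted_box h u i) (etrans _ (esym (emitted_box h v i))).
apply: uv; rewrite /rank tx; case: (from i) => y /= yw.
case ty : (Defs.tail (tag y)) => [s|w'] //=.
rewrite ltnS; apply: e_rank; apply/orP; left.
by apply/existsP; exists (tag y); rewrite (eqP yw) ty !eqxx.
Qed.

Definition join_out t (b : bas (all_wires carry)) (c : {ffun X -> bas r}) :
    bas (enlarge r (out t)) :=
  join (sub_out t b) [ffun i : out t => c (val i)].

Definition join_in n (b : bas (all_wires carry)) (c : {ffun X -> bas r}) :
    bas (enlarge r (inn n)) :=
  join (sub_in n b) [ffun i : inn n => c (val i)].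

(** Each register index occurs once at the tail and once at the head of its wire. The contraction is
    thus a product over wires of pairings of [Q (u x)] with [phi (emitted h u x)], that is, of
    Kronecker deltas. *)
Lemma sum_registers (h : {ffun source C -> G}) (u : {ffun X -> G}) :
  \sum_(c : {ffun X -> bas r})
    (\prod_s \prod_(i : out (inl s)) phi (h s) (c (val i))) *
    (\prod_v ((\prod_(i : inn (inl v)) Q (u (val i)) (c (val i))) *
       \prod_(j : out (inr v)) phi (u (val (from j))) (c (val j)))) *
    (\prod_p \prod_(i : inn (inr p)) Q (u (val i)) (c (val i))) =
  (u == emitted h u)%:R.
Proof.
transitivity (\sum_(c : {ffun X -> bas r}) \prod_x
   (Q (u x) (c x) * phi (emitted h u x) (c x))).
  apply: eq_bigr => c _; rewrite big_split [RHS]big_split /=.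
  rewrite [X in _ * X * _]mulrC mulrA -mulrA mulrC.
  congr (_ * _).
    exact: (prod_fibres_val (fun x : X => Defs.head (tag x)) (fun x => Q (u x) (c x))).
  rewrite -(prod_fibres_val (fun x : X => Defs.tail (tag x))
    (fun x => phi (emitted h u x) (c x))).
  congr (_ * _); apply: eq_bigr => n _; apply: eq_bigr => i _.
    by rewrite emitted_source.
  by rewrite emitted_box.
rewrite -(bigA_distr_bigA (fun x d => Q (u x) d * phi (emitted h u x) d)).
transitivity (\prod_x (u x == emitted h u x)%:R : R).
  by apply: eq_bigr => x _; exact: phiQ.
have [<-|/eqP ne] := eqVneq u (emitted h u).
  by rewrite big1 // => x _; rewrite eqxx.
have [x /negPf nex] : exists x, u x != emitted h u x.
  apply/existsP; apply: contra_notT ne => /existsPn ne.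
  by apply/ffunP => x; have /negPn/eqP := ne x.
by rewrite (bigD1 x) //= nex mul0r.
Qed.

Lemma network_encode :
  \sum_b \sum_c
    (\prod_s encode_state alpha phi (rho s) (join_out (inl s) b c))
    * (\prod_v encode_map alpha phi Q (@from v) (F v)
         (join_out (inr v) b c, join_in (inl v) b c))
    * (\prod_p encode_effect alpha Q (E p) (join_in (inr p) b c))
  = network rho F E.
Proof.
(* One factor from the average at each source; it is cancelled at the end by the number of choices
   of [h]. *)
pose K := #|G|%:R^-1 ^+ #|source C| : R.
pose ps (h : {ffun source C -> G}) b :=
  \prod_s act_state alpha (fun=> h s) (rho s) (sub_out (inl s) b).
pose pv (u : {ffun X -> G}) b :=
  \prod_v act_map alpha (res_in (inl v) u) (fun j => u (val (from j))) (F v)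
    (sub_out (inr v) b, sub_in (inl v) b).
pose pp (u : {ffun X -> G}) b :=
  \prod_p act_effect alpha (res_in (inr p) u) (E p) (sub_in (inr p) b).
transitivity (K * \sum_h \sum_u (u == emitted h u)%:R * \sum_b ps h b * pv u b * pp u b).
  pose reg (h : {ffun source C -> G}) (u : {ffun X -> G}) (c : {ffun X -> bas r}) :=
    (\prod_s \prod_(i : out (inl s)) phi (h s) (c (val i))) *
    (\prod_v ((\prod_(i : inn (inl v)) Q (u (val i)) (c (val i))) *
       \prod_(j : out (inr v)) phi (u (val (from j))) (c (val j)))) *
    (\prod_p \prod_(i : inn (inr p)) Q (u (val i)) (c (val i))).
  transitivity (\sum_b \sum_c K * \sum_h \sum_u
    (ps h b * pv u b * pp u b) * reg h u c); last first.
    under eq_bigr do rewrite -mulr_sumr.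
    rewrite -mulr_sumr; congr (K * _).
    transitivity (\sum_b \sum_h \sum_u \sum_c (ps h b * pv u b * pp u b) * reg h u c).
      apply: eq_bigr => b _; rewrite exchange_big; apply: eq_bigr => h _.
      exact: exchange_big.
    rewrite exchange_big; apply: eq_bigr => h _.
    rewrite exchange_big; apply: eq_bigr => u _.
    rewrite mulr_sumr; apply: eq_bigr => b _.
    by rewrite -mulr_sumr sum_registers mulrC.
  apply: eq_bigr => b _; apply: eq_bigr => c _.
  have -> : \prod_s encode_state alpha phi (rho s) (join_out (inl s) b c) =
      K * \sum_h ps h b * \prod_s \prod_(i : out (inl s)) phi (h s) (c (val i)).
    under eq_bigr do rewrite ffunE.
    rewrite big_split prodr_const bigA_distr_bigA; congr (_ * _).
    apply: eq_bigr => h _; rewrite /ps -big_split; apply: eq_bigr => s _ /=.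
    rewrite [LHS]ffunE bas_wires_join; congr (_ * _); apply: eq_bigr => i _.
    by rewrite bas_register_join ffunE.
  rewrite -!mulrA; congr (K * _).
  rewrite mulr_suml; apply: eq_bigr => h _.
  rewrite -mulrA.
  have -> : \prod_v encode_map alpha phi Q (@from v) (F v)
         (join_out (inr v) b c, join_in (inl v) b c) =
    \prod_v \sum_(d : {ffun inn (inl v) -> G})
      act_map alpha d (fun j => d (from j)) (F v)
        (sub_out (inr v) b, sub_in (inl v) b) *
      ((\prod_(i : inn (inl v)) Q (d i) (c (val i))) *
       \prod_(j : out (inr v)) phi (d (from j)) (c (val j))).
    apply: eq_bigr => v _; rewrite ffunE; apply: eq_bigr => d _ /=.
    rewrite -mulrA !bas_wires_join; congr (_ * (_ * _)); apply: eq_bigr => i _;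
      by rewrite bas_register_join ffunE.
  have -> : \prod_p encode_effect alpha Q (E p) (join_in (inr p) b c) =
    \prod_p \sum_(d : {ffun inn (inr p) -> G})
      act_effect alpha d (E p) (sub_in (inr p) b) *
      \prod_(i : inn (inr p)) Q (d i) (c (val i)).
    apply: eq_bigr => p _; rewrite ffunE; apply: eq_bigr => d _ /=.
    rewrite bas_wires_join; congr (_ * _); apply: eq_bigr => i _;
      by rewrite bas_register_join ffunE.
  (* Every wire has exactly one head, so the tuples read at the boxes and parties assemble into a
     single assignment [u] on all wires. *)
  rewrite (sum_fibres_sum (hd := fun x : X => Defs.head (tag x)) (D := fun=> G)
    (fun v (d : {ffun inn (inl v) -> G}) =>
      act_map alpha d (fun j => d (from j)) (F v)
        (sub_out (inr v) b, sub_in (inl v) b) *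
      ((\prod_(i : inn (inl v)) Q (d i) (c (val i))) *
       \prod_(j : out (inr v)) phi (d (from j)) (c (val j))))
    (fun p (d : {ffun inn (inr p) -> G}) =>
      act_effect alpha d (E p) (sub_in (inr p) b) *
      \prod_(i : inn (inr p)) Q (d i) (c (val i)))).
  rewrite !mulr_sumr; apply: eq_bigr => u _.
  rewrite !big_split /= [X in _ * (_ * X)]mulrACA [X in _ * X]mulrCA.
  rewrite /reg big_split /= -!mulrA; congr (_ * (_ * (_ * (_ * (_ * (_ * _)))))).
  - apply: eq_bigr => v _; congr (act_map _ _ _ _ _); apply/funext => i;
      by rewrite ffunE.
  - apply: eq_bigr => p _; congr (act_effect _ _ _ _); apply/funext => i.
    by rewrite ffunE.
  - by apply: eq_bigr => v _; apply: eq_bigr => i _; rewrite ffunE.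
  - by apply: eq_bigr => v _; apply: eq_bigr => i _; rewrite ffunE.
  - by apply: eq_bigr => p _; apply: eq_bigr => i _; rewrite ffunE.
(* For consistent [u], the element [h s] of a source and the inherited element [u (val (from j))]
   both equal the value of [u] on the wire itself; only then are all components transformed by the
   one tuple [u], as [network_act] requires. *)
have step h u : (u == emitted h u)%:R * (\sum_b ps h b * pv u b * pp u b) =
    (u == emitted h u)%:R * network rho F E.
  have [uE|_] := eqVneq u (emitted h u); last by rewrite !mul0r.
  rewrite !mul1r -(network_act u); apply: eq_bigr => b _.
  congr (_ * _ * _).
    apply: eq_bigr => s _; congr (act_state _ _ _ _); apply/funext => i.
    by rewrite uE emitted_source.
  apply: eq_bigr => v _; congr (act_map _ _ _ _ _); apply/funext => i.
  by rewrite [in RHS]uE emitted_box.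
under eq_bigr => h _.
  under eq_bigr do rewrite step.
  have [u0 u0E] := emitted_fixed_point h.
  rewrite -mulr_suml; under eq_bigr do rewrite u0E.
  rewrite (bigD1 u0) //= eqxx big1 ?addr0 ?mul1r => [|u /negPf-> //]; over.
rewrite sumr_const card_ffun -mulr_natl mulrA natrX -exprMn mulVf ?expr1n ?mul1r //.
by rewrite pnatr_eq0 -lt0n; apply/card_gt0P; exists 1%g.
Qed.
End Network.

(** * The encoded realisation *)

Section Realisation.
Variables (R : realType) (W : wire_kind) (T : theory R W).
Variables (G : finGroupType) (alpha : waction R W G) (r : system W).
Variables phi Q : G -> vec R r.
Hypothesis hT : is_gpt T.

Lemma state_sub_pull (S S' : system W) (f : S' -> S)
    (e : forall i, wire_at S' i = wire_at S (f i)) (x : vec R S') :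
  bijective f -> state (subtheory alpha T) x ->
  state (subtheory alpha T) (vec_pull e x).
Proof.
move=> fbij [xT xG]; split=> [|g]; first exact: state_pull.
by rewrite act_state_pull // xG.
Qed.

Lemma measurement_sub_pull (S S' : system W) (f : S' -> S)
    (e : forall i, wire_at S' i = wire_at S (f i)) (K : finType) (E : K -> vec R S') :
  bijective f -> measurement (subtheory alpha T) E ->
  measurement (subtheory alpha T) (fun k => vec_pull e (E k)).
Proof.
move=> fbij [ET EU]; split=> [k|].
  have [EkT EkG] := ET k; split=> [|g]; first exact: effect_pull.
  by rewrite act_effect_pull // EkG.
rewrite -[RHS](unit_effect_pull e fbij T) -[unit_effect T _]EU.
by apply/ffunP => b; rewrite ffunE !sum_ffunE; apply: eq_bigr => k _; rewrite ffunE.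
Qed.

Lemma instrument_sub_pull (S1 S1' S2 S2' : system W) (f1 : S1' -> S1) (f2 : S2' -> S2)
    (e1 : forall i, wire_at S1' i = wire_at S1 (f1 i))
    (e2 : forall i, wire_at S2' i = wire_at S2 (f2 i))
    (L : finType) (l1' : S1' -> L) (l2' : S2' -> L) (l1 : S1 -> L) (l2 : S2 -> L)
    (K : finType) (F : K -> Defs.hom R S1' S2') :
  bijective f1 -> bijective f2 ->
  (forall i, l1' i = l1 (f1 i)) -> (forall i, l2' i = l2 (f2 i)) ->
  instrument (subtheory alpha T) l1' l2' F ->
  instrument (subtheory alpha T) l1 l2 (fun k => hom_pull e1 e2 (F k)).
Proof.
move=> f1bij f2bij el1 el2 [FT [sT sG]]; split=> [k|].
  have [FkT FkG] := FT k; split=> [|g].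
    exact: (map_class_pull e1 f1bij e2 f2bij (gpt_admissible_class hT) el1 el2).
  by rewrite act_map_pull // FkG.
have -> : \sum_k hom_pull e1 e2 (F k) = hom_pull e1 e2 (\sum_k F k).
  by apply/ffunP => b; rewrite ffunE !sum_ffunE; apply: eq_bigr => k _; rewrite ffunE.
split=> [|g].
  exact: (map_class_pull e1 f1bij e2 f2bij (gpt_operation_class hT) el1 el2).
by rewrite act_map_pull // sG.
Qed.

Hypothesis hG : is_symmetry alpha T.
Hypothesis H1 : reference_frame alpha T phi Q.
Hypothesis H4 : encodings_admitted alpha T phi Q.

Lemma encode_measurement (S : system W) (K : finType) (E : K -> vec R S) :
  measurement T E ->
  measurement (subtheory alpha T) (fun k => encode_effect alpha Q (E k)).
Proof.
move=> [ET EU]; split=> [k|]; first exact: encode_effect_sub H1 H4 _ _ (ET k).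
by rewrite sum_encode_effect EU (encode_unit hT hG H1).
Qed.

Lemma encode_instrument (L : finType) (S S' : system W) (lin : S -> L)
    (lout : S' -> L) (K : finType) (F : K -> Defs.hom R S S') :
  (0 < #|S|)%N -> instrument T lin lout F ->
  exists from : S' -> S,
    instrument (subtheory alpha T) (enlarge_label (r := r) lin)
      (enlarge_label (r := r) lout) (fun k => encode_map alpha phi Q from (F k)).
Proof.
move=> S0 [FT sT].
have [linI loutI] := mc_labels (gpt_operation_class hT) sT.
have [from [_ opT admT]] := enc_map H4 S0 linI loutI.
exists from; split=> [k|]; first by split; [exact: admT|exact: (act_encode_map H1)].
rewrite -encode_map_sum; split; [exact: opT|exact: (act_encode_map H1)].
Qed.

(** * Networks whose edges carry registers *)

Variables (C : causal_structure) (carry : edge C -> system W).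

Definition enlarge_carry (e : edge C) : system W := enlarge r (carry e).

(** Both [is_out] and [is_in] are instances, so one renaming serves tails and heads. *)
Definition on_edges (carry : edge C -> system W) (q : pred (edge C)) :
    pred (all_wires carry) := fun x => q (tag x).

Definition edge_sub (carry : edge C -> system W) (q : pred (edge C)) : system W :=
  subsystem (@on_edges carry q).

Definition enlarge_all (x : enlarge r (all_wires carry)) : all_wires enlarge_carry :=
  match x with
  | inl x => existT (fun e => idx (enlarge_carry e)) (tag x) (inl (tagged x))
  | inr (x, j) => existT (fun e => idx (enlarge_carry e)) (tag x) (inr (tagged x, j))
  end.

Lemma enlarge_all_wire x :
  wire_at (enlarge r (all_wires carry)) x = wire_at (all_wires enlarge_carry) (enlarge_all x).
Proof. by case: x => [x|[x j]]. Qed.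

Lemma enlarge_all_bij : bijective enlarge_all.
Proof.
exists (fun x : all_wires enlarge_carry => match tagged x with
  | inl y => inl (existT (fun e => idx (carry e)) (tag x) y)
  | inr (y, j) => inr (existT (fun e => idx (carry e)) (tag x) y, j)
  end) => [[[e x]|[[e x] j]]|[e [x|[x j]]]] //.
Qed.

Definition enlarge_edge (q : pred (edge C)) (x : enlarge r (edge_sub carry q)) :
    edge_sub enlarge_carry q :=
  match x with
  | inl x => exist (@on_edges enlarge_carry q)
      (enlarge_all (inl (sval x))) (proj2_sig x)
  | inr (x, j) => exist (@on_edges enlarge_carry q)
      (enlarge_all (inr (sval x, j))) (proj2_sig x)
  end.

Lemma enlarge_edge_wire q x :
  wire_at (enlarge r (edge_sub carry q)) x =
  wire_at (edge_sub enlarge_carry q) (enlarge_edge x).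
Proof. by case: x => [x|[x j]]. Qed.

Lemma enlarge_edge_bij q : bijective (@enlarge_edge q).
Proof.
exists (fun x : edge_sub enlarge_carry q =>
  match x with
  | exist (existT e (inl y)) p =>
      inl (exist (@on_edges carry q) (existT (fun e => idx (carry e)) e y) p)
  | exist (existT e (inr (y, j))) p =>
      inr (exist (@on_edges carry q) (existT (fun e => idx (carry e)) e y) p, j)
  end) => [[[[e x] p]|[[[e x] p] j]]|[[e [x|[x j]]] p]] //.
Qed.

Lemma pull_edge q (b : bas (all_wires enlarge_carry)) :
  let d := pull enlarge_all_wire b in
  pull (@enlarge_edge_wire q) (bas_sub (@on_edges enlarge_carry q) b) =
  join (bas_sub (@on_edges carry q) (bas_wires d))
    [ffun i : edge_sub carry q => bas_register d (val i)].
Proof.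
apply/ffunP => -[[[e x] p]|[[[e x] p] j]]; by rewrite !ffunE /= !cast_ord_id.
Qed.

(** Labels are set on the whole enlarged network, which makes them consistent along edges; at each
    node they restrict to [enlarge_label]. *)
Definition enlarge_carry_label (L : finType) (l : all_wires carry -> L)
    (x : all_wires enlarge_carry) : (L + L * idx r)%type :=
  match tagged x with
  | inl y => inl (l (existT (fun e => idx (carry e)) (tag x) y))
  | inr (y, j) => inr (l (existT (fun e => idx (carry e)) (tag x) y), j)
  end.

Lemma enlarge_edge_label (L : finType) (l : all_wires carry -> L) q
    (i : enlarge r (edge_sub carry q)) :
  enlarge_label (r := r) (fun i : edge_sub carry q => l (val i)) i =
  enlarge_carry_label l (val (enlarge_edge i)).
Proof. by case: i => [[[e x] p]|[[[e x] p] j]]. Qed.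

(** Adjoining registers to the wires of a node and selecting the wires of enlarged edges give
    differently nested names. After renaming, a basis index splits into its wire and register parts,
    as in [network_encode]. *)
Lemma network_enlarge
    (rho : forall s, vec R (out_sys carry (inl s)))
    (F : forall v, Defs.hom R (in_sys carry (inl v)) (out_sys carry (inr v)))
    (E : forall p, vec R (in_sys carry (inr p)))
    (from : forall v, out_sys carry (inr v) -> in_sys carry (inl v)) :
  network (carry := enlarge_carry)
    (fun s => vec_pull (@enlarge_edge_wire (fun e => Defs.tail e == inl s))
       (encode_state alpha phi (rho s)))
    (fun v => hom_pull (@enlarge_edge_wire (fun e => Defs.head e == inl v))
       (@enlarge_edge_wire (fun e => Defs.tail e == inr v))
       (encode_map alpha phi Q (@from v) (F v)))
    (fun p => vec_pull (@enlarge_edge_wire (fun e => Defs.head e == inr p))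
       (encode_effect alpha Q (E p)))
  = network rho F E.
Proof.
rewrite -(network_encode alpha rho F E (frame_pairing H1) from).
pose reg (d : bas (enlarge r (all_wires carry))) :=
  [ffun i : all_wires carry => bas_register d i].
pose Phi (b : bas (all_wires carry)) (c : {ffun all_wires carry -> bas r}) :=
  (\prod_s encode_state alpha phi (rho s) (join_out (inl s) b c))
  * (\prod_v encode_map alpha phi Q (@from v) (F v)
       (join_out (inr v) b c, join_in (inl v) b c))
  * (\prod_p encode_effect alpha Q (E p) (join_in (inr p) b c)).
transitivity (\sum_d Phi (bas_wires d) (reg d)); last first.
  rewrite sum_enlarge; apply: eq_bigr => b _; apply: eq_bigr => c _.
  rewrite bas_wires_join; congr Phi.
  by apply/ffunP => i; rewrite ffunE bas_register_join.
rewrite -(sum_pull enlarge_all_wire enlarge_all_bij).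
have pull_join q b : pull (@enlarge_edge_wire q) (bas_sub (@on_edges enlarge_carry q) b) =
    join (bas_sub (@on_edges carry q) (bas_wires (pull enlarge_all_wire b)))
      [ffun i : edge_sub carry q => reg (pull enlarge_all_wire b) (val i)].
  rewrite pull_edge; congr join.
  by apply/ffunP => i; rewrite !ffunE.
apply: eq_bigr => b _; congr (_ * _ * _); apply: eq_bigr => n _; rewrite ffunE.
- by congr (encode_state _ _ _ _); exact: pull_join.
- congr (encode_map _ _ _ _ _ _); congr (_, _); exact: pull_join.
- by congr (encode_effect _ _ _ _); exact: pull_join.
Qed.

End Realisation.

Theorem theorem20 (R : realType) (W : wire_kind) (T : theory R W)
  (G : finGroupType) (alpha : waction R W G) (r : system W)
  (phi Q : G -> vec R r)
  (hT : is_gpt T)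
  (hG : is_symmetry alpha T)
  (H1 : reference_frame alpha T phi Q)
  (H2 : frame_corr_states alpha T phi)
  (H3 : sectorially_closed alpha T)
  (H4 : encodings_admitted alpha T phi Q)
  (C : causal_structure) (P : outcomes C -> settings C -> R) :
  corr T P <-> corr (subtheory alpha T) P.
Proof.
split=> [[x Px]|[x Px]]; last first.
  (* An invariant realisation has components in [T], and [prob] depends on the components alone. *)
  have prepT s : state T (prep x s) by have [] := prep_state x s.
  have instT v d : instrument T (fun i : in_sys (carry x) (inl v) => label_of (val i))
      (fun i : out_sys (carry x) (inr v) => label_of (val i)) (inst x (v := v) d).
    have [FT [sT _]] := inst_instrument x d; split=> // k.
    by have [] := FT k.
  have measT p d : measurement T (meas x (p := p) d).
    have [ET sT] := meas_measurement x d; split=> // k.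
    by have [] := ET k.
  by exists (Realisation prepT (inst_input x) instT measT).
(* The inheritance map may vary with the classical data [d]. This is harmless: for given settings
   and outcomes each box sees one value of [d], and [network_enlarge] is applied with the
   corresponding choices. *)
have from_ex v (d : seen (C := C) (inl v)) :=
  cid (encode_instrument hT H1 H4 (inst_input x v) (inst_instrument x d)).
pose from v d := sval (from_ex v d).
pose tails t := @enlarge_edge_wire W r C (carry x) (fun e => Defs.tail e == t).
pose heads n := @enlarge_edge_wire W r C (carry x) (fun e => Defs.head e == n).
have prepS s : state (subtheory alpha T)
    (vec_pull (tails (inl s)) (encode_state alpha phi (prep x s))).
  apply: (state_sub_pull hT); first exact: enlarge_edge_bij.
  by apply: (encode_state_sub hT hG H1); exact: prep_state.
have inputS v : (0 < #|in_sys (enlarge_carry r (carry x)) (inl v)|)%N.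
  have /card_gt0P[i _] := inst_input x v.
  apply/card_gt0P; exists (@enlarge_edge W r C (carry x) (fun e => Defs.head e == inl v) (inl i)).
  by [].
have instS v d : instrument (subtheory alpha T)
    (fun i : in_sys (enlarge_carry r (carry x)) (inl v) =>
       enlarge_carry_label (@label_of _ _ _ _ x) (val i))
    (fun i : out_sys (enlarge_carry r (carry x)) (inr v) =>
       enlarge_carry_label (@label_of _ _ _ _ x) (val i))
    (fun k => hom_pull (heads (inl v)) (tails (inr v))
       (encode_map alpha phi Q (from v d) (inst x d k))).
  apply: (instrument_sub_pull hT); [exact: enlarge_edge_bij|exact: enlarge_edge_bij
    |exact: enlarge_edge_label|exact: enlarge_edge_label|].
  exact: svalP (from_ex v d).
have measS p d : measurement (subtheory alpha T)
    (fun k => vec_pull (heads (inr p)) (encode_effect alpha Q (meas x (p := p) d k))).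
  apply: (measurement_sub_pull hT); first exact: enlarge_edge_bij.
  by apply: (encode_measurement hT hG H1 H4); exact: meas_measurement.
exists (Realisation prepS inputS instS measS) => a s.
rewrite Px; exact/esym/(network_enlarge H1).
Qed.
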